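(* Let $\Psi_0(s)=5s^3-3s$ be the stream function of the $3$-jet and consider the Euler equation on the rotating unit sphere with rotation rate $\omega$. (1) Let $\omega\in(-3,\tfrac{69}{2})$. For any $\varepsilon>0$ there exists a cat's eyes travelling wave $\Psi_{1,\varepsilon}(\varphi-c_{1,\varepsilon}t,s)$ satisfying $\|\Psi_{1,\varepsilon}-\Psi_0\|_{\mathcal{G}_\lambda}<\varepsilon$. (2) Let $\omega\in(-18,-3)\cup(\tfrac{69}{2},72)$. Then for any $\varepsilon>0$ there exist both a cat's eyes travelling wave $\Psi_{2,\varepsilon}(\varphi-c_{2,\varepsilon}t,s)$ and a non-zonal unidirectional travelling wave $\Psi_{3,\varepsilon}(\varphi-c_{3,\varepsilon}t,s)$ satisfying $$\|\Psi_{2,\varepsilon}-\Psi_0\|_{\mathcal{G}_\lambda}<\varepsilon\quad\text{and}\quad \|\Psi_{3,\varepsilon}-\Psi_0\|_{H_2^4(\mathbb{S}^2)}<\varepsilon .$$ (3) Let $\omega\in(-\infty,-18)\cup(72,\infty)$. For any $\varepsilon>0$ there exists a non-zonal unidirectional travelling wave $\Psi_{4,\varepsilon}(\varphi-c_{4,\varepsilon}t,s)$ satisfying $\|\Psi_{4,\varepsilon}-\Psi_0\|_{\mathcal{G}_\lambda}<\varepsilon$.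
   Context: On $\mathbb{S}^2$ use the longitude $\varphi\in\mathbb{T}_{2\pi}$ and $s=\sin\theta\in[-1,1]$, $\theta$ the latitude. The Euler equation with rotation rate $\omega\in\mathbb{R}$, for the vorticity $\Upsilon=\Delta\Psi$ ($\Psi$ of zero mean), is $$\partial_t\Upsilon+(\partial_\varphi\Psi\,\partial_s-\partial_s\Psi\,\partial_\varphi)(\Upsilon+2\omega s)=0,\qquad \Delta\Psi=\partial_s\big((1-s^2)\partial_s\Psi\big)+\frac{1}{1-s^2}\partial_\varphi^2\Psi .$$ A travelling wave is a solution whose stream function has the form $\Psi(\varphi-ct,s)$ with travelling speed $c\in\mathbb{R}$; it is zonal if $\Psi$ depends only on $s$. Its streamlines are the level curves on $\mathbb{S}^2$ of the stream function $\Psi+cs$ in the frame moving with the wave. A cat's eyes travelling wave is one whose streamlines have at least one cat's eyes structure: a center of $\Psi+cs$ surrounded by closed streamlines contractible in $\mathbb{T}_{2\pi}\times(-1,1)$ (i.e. not encircling a pole), the region filled by these closed streamlines being bounded by separatrices through saddle points. A unidirectional travelling wave is one all of whose streamlines are unidirectional around the sphere: apart from two centers, there are no stagnation points of $\Psi+cs$ on $\mathbb{S}^2$, and every other streamline is a simple closed curve separating the two centers. $\|\cdot\|_{\mathcal{G}_\lambda}$ is the Gevrey-$1$ (analytic) norm, with $\lambda>0$ fixed: for $f=\sum_{l,m}f_{l,m}Y_l^m$ expanded in orthonormal spherical harmonics, $\|f\|_{\mathcal{G}_\lambda}^2=\sum_{l,m}e^{2\lambda l}|f_{l,m}|^2$.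 $H_2^4(\mathbb{S}^2)$ denotes the $L^2$-based Sobolev space of order $4$ on $\mathbb{S}^2$. *)

(* Defs.v *)
From HB Require Import structures.
From mathcomp Require Import all_boot all_order all_algebra.
From mathcomp Require Import all_classical all_reals all_analysis.
From mathcomp Require Import complex.

Set Implicit Arguments.
Unset Strict Implicit.
Unset Printing Implicit Defensive.

Import Order.TTheory GRing.Theory Num.Theory.
Import numFieldNormedType.Exports.

Local Open Scope ring_scope.
Local Open Scope classical_set_scope.

(* A function on the unit sphere is represented by a function on R^3 of which
   only the values on [sphere] matter.  On 'rV[R]_3 the library norm is the
   sup norm, hence the separate Euclidean norm. *)

Section Sphere.
Variable R : realType.
Local Notation E := 'rV[R]_3.
Implicit Types (F h Psi : E -> R) (x y p q : E).

Definition dotv x y : R := \sum_i x 0 i * y 0 i.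

Definition enorm x : R := Num.sqrt (dotv x x).

Definition sphere : set E := [set x | enorm x = 1].

(* the coordinate s = sin(latitude) *)
Definition height x : R := x 0 ord_max.

Definition sph (phi s : R) : E :=
  \row_(i < 3) [:: Num.sqrt (1 - s ^+ 2) * cos phi;
                   Num.sqrt (1 - s ^+ 2) * sin phi;
                   s]`_i.

Definition north_pole : E := sph 0 1.
Definition south_pole : E := sph 0 (-1).

Definition coord F (phi s : R) : R := F (sph phi s).

(* homogeneous extension of degree 0 of the restriction of F to the sphere *)
Definition hext F x : R := F ((enorm x)^-1 *: x).

Fixpoint Ck (k : nat) (U : set E) F : Prop :=
  if k is k'.+1 then
    (forall x, U x -> differentiable F x) /\ forall v : E, Ck k' U ('D_v F)
  else forall x, U x -> {for x, continuous F}.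

Definition sphereC (k : nat) F : Prop := Ck k [set x | x != 0] (hext F).

Definition sphere_integral (u : R -> R -> R) : R :=
  \int[lebesgue_measure]_(s in `[-1, 1])
    \int[lebesgue_measure]_(phi in `[0, 2 * pi]) u phi s.

Definition laplacian (u : R -> R -> R) (phi s : R) : R :=
  derive1 (fun s' => (1 - s' ^+ 2) * derive1 (u phi) s') s
  + (1 - s ^+ 2)^-1 * derive1n 2 (fun phi' => u phi' s) phi.

(* Associated Legendre function by Rodrigues' formula, without the
   Condon-Shortley sign; phases of the Y_l^m are irrelevant below, as only the
   moduli of the coefficients are used. *)
Definition legendre (l m : nat) (s : R) : R :=
  Num.sqrt (1 - s ^+ 2) ^+ m
  * (derivn (l + m) (('X^2 - 1) ^+ l)).[s] / (2 ^+ l * l`!%:R).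

Definition sphY (l : nat) (m : int) (phi s : R) : R[i] :=
  let N := Num.sqrt ((2 * l + 1)%:R / (4 * pi)
                     * ((l - `|m|)`!%:R / (l + `|m|)`!%:R)) in
  (N * legendre l `|m| s)%:C%C
  * (cos (m%:~R * phi) +i* sin (m%:~R * phi))%C.

(* the L^2 inner product of the real function F with Y_l^m *)
Definition sph_coef F (l : nat) (m : int) : R[i] :=
  (sphere_integral (fun phi s => coord F phi s * complex.Re (sphY l m phi s))
   -i* sphere_integral
         (fun phi s => coord F phi s * complex.Im (sphY l m phi s)))%C.

Definition sph_energy F (l : nat) : R :=
  \sum_(j < l.*2.+1) Normc.normc (sph_coef F l (j%:Z - l%:Z)) ^+ 2.

Definition gevrey_norm (lambda : R) F : \bar R :=
  sqrte (\sum_(0 <= l <oo) (expR (2 * lambda * l%:R) * sph_energy F l)%:E)%E.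

(* l (l + 1) is the eigenvalue of minus the Laplacian at degree l *)
Definition sobolev_norm (k : nat) F : \bar R :=
  sqrte (\sum_(0 <= l <oo) ((1 + (l * l.+1)%:R) ^+ k * sph_energy F l)%:E)%E.

(* Classical solutions: Psi is C^2 and Upsilon is C^1 on the whole sphere, and
   the equations hold in the coordinates (phi, s), i.e. off the poles. *)
Definition euler_solution (omega : R) (Psi Upsilon : R -> E -> R) : Prop :=
  [/\ forall t, sphereC 2 (Psi t) /\ sphereC 1 (Upsilon t),
      forall t, sphere_integral (coord (Psi t)) = 0,
      forall t phi s : R, -1 < s < 1 ->
        coord (Upsilon t) phi s = laplacian (coord (Psi t)) phi s
    & forall t phi s : R, -1 < s < 1 ->
        let absvort phi' s' := coord (Upsilon t) phi' s' + 2 * omega * s' in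
        derivable (fun t' => coord (Upsilon t') phi s) t 1 /\
        derive1 (fun t' => coord (Upsilon t') phi s) t
        + derive1 (fun phi' => coord (Psi t) phi' s) phi
          * derive1 (absvort phi) s
        - derive1 (coord (Psi t) phi) s
          * derive1 (fun phi' => absvort phi' s) phi = 0].

Definition travelling_wave (omega : R) Psi (c : R) : Prop :=
  exists U Upsilon : R -> E -> R, euler_solution omega U Upsilon /\
    forall t phi s : R, -1 <= s <= 1 ->
      coord (U t) phi s = coord Psi (phi - c * t) s.

Definition zonal Psi : Prop :=
  forall phi phi' s : R, -1 <= s <= 1 -> coord Psi phi s = coord Psi phi' s.

(* stream function in the frame moving with the wave *)
Definition moving_frame Psi (c : R) : E -> R := fun x => Psi x + c * height x.

Definition streamline h p : set E :=
  connected_component (sphere `&` [set x | h x = h p]) p.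

Definition stagnation h p : Prop :=
  sphere p /\ forall v : E, 'D_v (hext h) p = 0.

(* nondegenerate: the Hessian on the tangent plane is indefinite *)
Definition saddle h p : Prop :=
  [/\ stagnation h p,
      exists v : E, dotv v p = 0 /\ 0 < 'D_v ('D_v (hext h)) p
    & exists w : E, dotv w p = 0 /\ 'D_w ('D_w (hext h)) p < 0].

Definition simple_loop (gamma : R -> E) (C : set E) : Prop :=
  [/\ {within `[0, 1], continuous gamma},
      gamma 0 = gamma 1,
      {in `[0, 1[ &, injective gamma}
    & gamma @` `[0, 1] = C].

Definition simple_closed_curve (C : set E) : Prop :=
  exists gamma, simple_loop gamma C.

Definition closed_streamline h p : Prop :=
  simple_closed_curve (streamline h p) /\
  forall q, streamline h p q -> ~ stagnation h q.

(* No neighbouring streamline passes through the stagnation point p, so h has a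
   strict local extremum at p and the neighbouring closed streamlines encircle
   p; the definitions below also state the encircling that they need. *)
Definition center h p : Prop :=
  stagnation h p /\
  \forall q \near p, sphere q -> q <> p -> closed_streamline h q.

Definition separates (C : set E) p q : Prop :=
  [/\ ~ C p, ~ C q & ~ connected_component (sphere `\` C) p q].

(* the sphere without its poles, i.e. T x (-1, 1) *)
Definition cylinder : set E := sphere `\` [set north_pole; south_pole].

(* C is a simple closed curve that is freely homotopic to a point in A *)
Definition contractible_curve (A C : set E) : Prop :=
  exists H : R * R -> E,
    [/\ {within `[0, 1] `*` `[0, 1], continuous H},
        H @` (`[0, 1] `*` `[0, 1]) `<=` A,
        simple_loop (fun a => H (a, 0)) C,
        forall tau : R, tau \in `[0, 1] -> H (0, tau) = H (1, tau)
      & exists y, forall a : R, a \in `[0, 1] -> H (a, 1) = y].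

(* B is a streamline arc connecting two (possibly equal) saddles *)
Definition separatrix h (B : set E) : Prop :=
  exists gamma : R -> E,
    [/\ {within `[0, 1], continuous gamma}
        /\ {in `]0, 1[ &, injective gamma},
        gamma @` `[0, 1] = B,
        B `<=` sphere /\ (forall x, B x -> h x = h (gamma 0)),
        saddle h (gamma 0) /\ saddle h (gamma 1)
      & forall a : R, a \in `]0, 1[ -> ~ stagnation h (gamma a)].

(* p is the center and D the region filled by the closed streamlines; as D is
   relatively open, closure D `\` D is its boundary in the sphere *)
Definition cats_eye h p (D : set E) : Prop :=
  [/\ center h p /\ D p,
      connected D /\ (exists U : set E, open U /\ D = sphere `&` U),
      forall x, D x -> x <> p ->
        [/\ streamline h x `<=` D,
            closed_streamline h x,
            contractible_curve cylinder (streamline h x),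
            separates (streamline h x) p north_pole
          & separates (streamline h x) p south_pole]
    & forall x, (closure D `\` D) x ->
        exists B : set E, [/\ separatrix h B, B `<=` closure D `\` D & B x]].

Definition cats_eyes_travelling_wave (omega : R) Psi (c : R) : Prop :=
  travelling_wave omega Psi c /\
  exists p D, cats_eye (moving_frame Psi c) p D.

Definition unidirectional_travelling_wave (omega : R) Psi (c : R) : Prop :=
  travelling_wave omega Psi c /\
  let h := moving_frame Psi c in
  exists p q, [/\ p <> q, center h p, center h q,
    forall x, stagnation h x -> x = p \/ x = q
  & forall x, sphere x -> x <> p -> x <> q ->
      simple_closed_curve (streamline h x) /\ separates (streamline h x) p q].

Definition three_jet : E -> R := fun x => 5 * height x ^+ 3 - 3 * height x.

End Sphere.

Arguments three_jet {R} x.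

(* Main.v *)
Require Import Defs.
From mathcomp Require Import all_boot all_order all_algebra.
From mathcomp Require Import all_classical all_reals all_analysis.
From mathcomp Require Import complex ring lra zify.

Import Order.TTheory GRing.Theory Num.Theory.
Import numFieldNormedType.Exports.
Local Open Scope ring_scope.
Local Open Scope classical_set_scope.

Set Implicit Arguments.
Unset Strict Implicit.
Unset Printing Implicit Defensive.

(** All the waves are explicit polynomials of degree at most three in the
    coordinates x, y, z (z is the coordinate s of the statement).

    Unidirectional waves.  In an inertial frame the sphere does not rotate, and
    every flow that is zonal about some axis, tilted or not, is steady there;
    back in the rotating frame it travels with speed -omega.  The 3-jet has the
    inertial stream function 5 z^3 - (3 + omega) z.  Replacing z by the linear
    form n.x, for a unit vector n close to the pole, gives a non-zonal wave as
    close to the 3-jet as desired, in any of the norms.  In the frame of the wave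
    the stream function is the cubic 5 t^3 - (3 + omega) t of t = n.x, which has
    no critical point on [-1, 1] if and only if 3 + omega is outside [0, 15], that
    is omega < -3 or 12 < omega.  Its streamlines are then the circles of axis n
    and its only stagnation points are n and -n
    (lemma [tilted_jet_unidirectional]).

    Cat's eyes.  If Psi is an eigenfunction of the Laplacian of degree three, then
    the vorticity is -12 Psi and the Euler equation in the moving frame becomes
    linear: Psi travels with speed -omega / 6.  Take the 3-jet minus
    e z (x^2 - y^2) with e > 0 small.  In the frame of the wave the stream function
    is h = 5 z^3 - k z - e z (x^2 - y^2) with k = 3 + omega / 6, and the zonal part
    has a critical latitude in each hemisphere if and only if k is in (0, 15), that
    is -18 < omega < 72.  On the sphere x can be eliminated, and in the quarter
    x, z > 0 a level set of h between the center and the saddles is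
      2 e y^2 = (5 + e) (z + 2 m) (d^2 - (z - m)^2) / z,
    where m - d and m + d are the extreme values of z and 3 m^2 + d^2 is constant.
    So z = m - d cos t parametrizes it, and shrinking d to 0 contracts it to the
    center.  The largest loop reaches the meridian x = 0 at two saddles, which cut
    it into the two separatrices (lemmas [cats_eye_eye] and [cats_eyes_wave]).

    Norms.  The difference with the 3-jet is a combination, with small
    coefficients, of functions r^j q(z) cos (j phi), r the cosine of the latitude
    and deg q + j <= 3.  Rodrigues' formula and repeated integration by parts show
    that it is orthogonal to all spherical harmonics of degree l > 3, so every norm
    that weights the degrees is a finite sum (lemma [weighted_norm_small]). *)

(** * Differentiation rules for functions given by formulas *)

Section Rules.
Variables (R : realType) (V : normedModType R).
Implicit Types (f g : V -> R) (x v : V).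

Lemma derC (c : R) x v : is_derive x v (fun=> c) 0.
Proof. exact: is_derive_cst. Qed.

Lemma derD f g x v a b : is_derive x v f a -> is_derive x v g b ->
  is_derive x v (fun y => f y + g y) (a + b).
Proof. exact: is_deriveD. Qed.

Lemma derN f x v a : is_derive x v f a -> is_derive x v (fun y => - f y) (- a).
Proof. exact: is_deriveN. Qed.

Lemma derB f g x v a b : is_derive x v f a -> is_derive x v g b ->
  is_derive x v (fun y => f y - g y) (a - b).
Proof. exact: is_deriveB. Qed.

Lemma derM f g x v a b : is_derive x v f a -> is_derive x v g b ->
  is_derive x v (fun y => f y * g y) (f x * b + g x * a).
Proof. exact: is_deriveM. Qed.

Lemma derX f x v a n : is_derive x v f a ->
  is_derive x v (fun y => f y ^+ n) (n%:R * f x ^+ n.-1 * a).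
Proof. by move=> fa; have := is_deriveX n fa; rewrite exprfctE. Qed.

Lemma der_sum n (f : 'I_n -> V -> R) (a : 'I_n -> R) x v :
  (forall i, is_derive x v (f i) (a i)) ->
  is_derive x v (fun y => \sum_(i < n) f i y) (\sum_(i < n) a i).
Proof. by move=> fa; have := is_derive_sum fa; rewrite fct_sumE. Qed.

(** This reduces the chain rule and second directional derivatives to functions
    of one real variable. *)
Lemma derive_line f x v t : 'D_v f (x + t *: v) = (fun t => f (x + t *: v))^`() t.
Proof.
have E : (fun h : R => h^-1 *: ((f \o shift (x + t *: v)) (h *: v) - f (x + t *: v))) =
    (fun h : R => h^-1 *: (((fun t => f (x + t *: v)) \o shift t) (h *: 1)
                            - f (x + t *: v))).
  by apply/funext => h /=; rewrite scalerDl [h *: 1]mulr1 addrCA.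
by rewrite derive1E /derive E.
Qed.

Lemma der_line f x v a :
  is_derive x v f a <-> is_derive (0 : R) 1 (fun t => f (x + t *: v)) a.
Proof.
have E : (fun h : R => h^-1 *: ((f \o shift x) (h *: v) - f x)) =
    (fun h : R => h^-1 *: (((fun t => f (x + t *: v)) \o shift (0 : R)) (h *: 1)
                            - f (x + 0 *: v))).
  apply/funext => h /=.
  by rewrite addr0 scale0r addr0 [h *: 1]mulr1 (addrC x).
by split=> -[d1 d2]; split; move: d1 d2; rewrite /derivable /derive ?E // -?E.
Qed.

Lemma der_comp (h : R -> R) f x v a b :
  is_derive (f x) 1 h a -> is_derive x v f b ->
  is_derive x v (fun y => h (f y)) (a * b).
Proof.
move=> ha /der_line fb; apply/der_line.
apply: (@is_derive1_comp R h (fun t => f (x + t *: v))) fb.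
by rewrite scale0r addr0.
Qed.

Lemma derV f x v a : f x != 0 -> is_derive x v f a ->
  is_derive x v (fun y => (f y)^-1) (- (f x) ^- 2 * a).
Proof.
move=> fx0 fa; apply: der_comp fa; apply: is_derive_eq.
  by apply: (@is_deriveV R id (f x) 1 1).
by rewrite [LHS]mulr1.
Qed.

End Rules.

(** Differentiability is expressed by a remainder that is small near the point,
    hence it is a local property. *)
Lemma near_differentiable (R : realType) (V : normedModType R) (f g : V -> R) x :
  (\near x, g x = f x) -> differentiable g x -> differentiable f x.
Proof.
move=> fg /diff_locallyP[dgc dg].
have fgx : g x = f x := nbhs_singleton fg.
have df : f \o shift x = cst (f x) + 'd g x +o_ 0 id.
  apply/eqaddoP => e e0; move/eqaddoP: dg => /(_ e e0) dg.
  rewrite -fgx; move: fg; rewrite (near_shift (0 : V)) subr0 => fg.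
  near=> h.
  have -> : (f \o shift x - (cst (g x) + 'd g x)) h =
            (g \o shift x - (cst (g x) + 'd g x)) h.
    rewrite !fctE /=; congr (_ - _); by apply/esym; near: h.
  by near: h.
apply/diff_locallyP; rewrite (diff_unique dgc df); split=> //.
Unshelve. all: by end_near. Qed.

(** These and the rules above have conclusions about explicit lambda terms, so
    that the derivative or the continuity of a formula is obtained by composing
    them along its syntax. *)
Section ContinuityRules.
Variables (R : realType) (T : topologicalType).
Implicit Types (f g : T -> R) (t : T).

Lemma ctC (c : R) t : {for t, continuous (fun=> c)}.
Proof. exact: cst_continuous. Qed.

Lemma ctD f g t : {for t, continuous f} -> {for t, continuous g} ->
  {for t, continuous (fun u => f u + g u)}.
Proof. by move=> fc gc; apply: continuousD. Qed.

Lemma ctN f t : {for t, continuous f} -> {for t, continuous (fun u => - f u)}.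
Proof. by move=> fc; apply: continuousN. Qed.

Lemma ctB f g t : {for t, continuous f} -> {for t, continuous g} ->
  {for t, continuous (fun u => f u - g u)}.
Proof. by move=> fc gc; apply: ctD => //; exact: ctN. Qed.

Lemma ctM f g t : {for t, continuous f} -> {for t, continuous g} ->
  {for t, continuous (fun u => f u * g u)}.
Proof. by move=> fc gc; apply: continuousM. Qed.

Lemma ctX f n t : {for t, continuous f} -> {for t, continuous (fun u => f u ^+ n)}.
Proof.
move=> fc; elim: n => [|n IHn]; first exact: ctC.
have -> : (fun u => f u ^+ n.+1) = (fun u => f u * f u ^+ n).
  by apply/funext => u; rewrite exprS.
exact: ctM.
Qed.

Lemma ctV f t : f t != 0 -> {for t, continuous f} ->
  {for t, continuous (fun u => (f u)^-1)}.
Proof. by move=> f0 fc; apply: continuousV. Qed.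

Lemma ct_comp (h : R -> R) f t : continuous h -> {for t, continuous f} ->
  {for t, continuous (fun u => h (f u))}.
Proof. by move=> hc fc; apply: continuous_comp (fc) (hc _). Qed.

End ContinuityRules.
Arguments ctC {R T} c t.
Arguments ctX {R T f} n {t} _.

Lemma is_derive_continuous (R : realType) (f : R -> R) (x a : R) :
  is_derive x (1 : R) f a -> {for x, continuous f}.
Proof. by move=> fa; apply/differentiable_continuous/derivable1_diffP/ex_derive. Qed.

Lemma der_unique (R : realType) (f : R -> R) (x a b : R) :
  is_derive x (1 : R) f a -> is_derive x (1 : R) f b -> a = b.
Proof. by move=> [_ <-] [_ <-]. Qed.

(** * Smoothness of polynomial functions on the sphere *)

Section Smooth.
Variable R : realType.
Local Notation E := 'rV[R]_3.
Implicit Types (F G : E -> R) (x v : E).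

Inductive polyfun : (E -> R) -> Prop :=
| polyfun_coord i : polyfun (fun x => x 0 i)
| polyfun_cst c : polyfun (fun=> c)
| polyfunD F G : polyfun F -> polyfun G -> polyfun (fun x => F x + G x)
| polyfunM F G : polyfun F -> polyfun G -> polyfun (fun x => F x * G x).

Lemma polyfunX F n : polyfun F -> polyfun (fun x => F x ^+ n).
Proof.
move=> pF; elim: n => [|n IHn]; first exact: polyfun_cst.
by under eq_fun do rewrite exprS; exact: polyfunM.
Qed.

Lemma polyfun_sum n (F : 'I_n -> E -> R) :
  (forall i, polyfun (F i)) -> polyfun (fun x => \sum_(i < n) F i x).
Proof.
elim: n F => [|n IHn] F pF.
  by under eq_fun do rewrite big_ord0; exact: polyfun_cst.
under eq_fun do rewrite big_ord_recl.
by apply: polyfunD => //; exact: IHn.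
Qed.

Lemma polyfun_horner F (p : {poly R}) :
  polyfun F -> polyfun (fun x => p.[F x]).
Proof.
move=> pF; under eq_fun do rewrite horner_coef.
by apply: polyfun_sum => i; apply: polyfunM; [exact: polyfun_cst|exact: polyfunX].
Qed.

(** This class contains the degree 0 extensions of polynomial functions and,
    unlike those, is stable under directional derivatives: one of the inverse of
    the radius is again a polynomial in it and the coordinates. *)
Inductive radial_polyfun : (E -> R) -> Prop :=
| radial_coord i : radial_polyfun (fun x => x 0 i)
| radial_cst c : radial_polyfun (fun=> c)
| radial_inv : radial_polyfun (fun x => (enorm x)^-1)
| radialD F G : radial_polyfun F -> radial_polyfun G ->
    radial_polyfun (fun x => F x + G x)
| radialM F G : radial_polyfun F -> radial_polyfun G ->
    radial_polyfun (fun x => F x * G x).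

Lemma radial_hext F : polyfun F -> radial_polyfun (hext F).
Proof.
rewrite /hext; elim=> {F} [i|c|F G _ rF _ rG|F G _ rF _ rG].
- under eq_fun do rewrite mxE.
  by apply: radialM; [exact: radial_inv|exact: radial_coord].
- exact: radial_cst.
- exact: radialD.
- exact: radialM.
Qed.

Lemma dotv_gt0 x : x != 0 -> 0 < dotv x x.
Proof.
move=> x0; rewrite lt_def sumr_ge0 ?andbT; last by move=> i _; rewrite -expr2 sqr_ge0.
apply: contra x0 => /eqP/psumr_eq0P x0; apply/eqP/rowP => i; rewrite mxE.
by apply/eqP; rewrite -[_ == 0]orbb -mulf_eq0; apply/eqP/x0 => // j _; rewrite -expr2 sqr_ge0.
Qed.

Lemma enorm_gt0 x : x != 0 -> 0 < enorm x.
Proof. by move=> x0; rewrite sqrtr_gt0 dotv_gt0. Qed.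

Lemma der_coord i x v : is_derive x v (fun x : E => x 0 i) (v 0 i).
Proof.
apply/der_line; under eq_fun do rewrite !mxE.
apply: is_derive_eq.
by rewrite scaler0 !add0r mul1r [_%:A]mulr1.
Qed.

Lemma der_inv_enorm x v : x != 0 ->
  is_derive x v (fun x => (enorm x)^-1) (- dotv x v * (enorm x)^-1 ^+ 3).
Proof.
move=> x0; have n0 := enorm_gt0 x0.
have d2 : is_derive x v (fun x => dotv x x) (2 * dotv x v).
  apply: is_derive_eq.
    by apply: der_sum => i; apply: derM; exact: der_coord.
  rewrite /dotv mulr_sumr; apply: eq_bigr => i _; ring.
have d1 := der_comp (f := fun x => dotv x x) (is_derive1_sqrt (dotv_gt0 x0)) d2.
apply: (is_derive_eq (derV _ d1)); first by rewrite gt_eqF.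
rewrite -/(enorm x); field; by rewrite gt_eqF.
Qed.

Lemma differentiable_inv_enorm x :
  x != 0 -> differentiable (fun x => (enorm x)^-1) x.
Proof.
move=> x0; apply: differentiableV; last by rewrite gt_eqF ?enorm_gt0.
apply: (@differentiable_comp _ _ _ _ (fun x => dotv x x) Num.sqrt).
  rewrite (_ : (fun x => _) = \sum_(i < 3) (fun x : E => x 0 i * x 0 i)).
    by apply: differentiable_sum => i; apply: differentiableM;
      exact: differentiable_coord.
  by rewrite fct_sumE.
by apply/derivable1_diffP; apply: ex_derive; exact/is_derive1_sqrt/dotv_gt0.
Qed.

Lemma radial_diff F : radial_polyfun F -> forall x, x != 0 -> differentiable F x.
Proof.
elim=> {F} [i|c||F G _ dF _ dG|F G _ dF _ dG] x x0.
- exact: differentiable_coord.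
- exact: differentiable_cst.
- exact: differentiable_inv_enorm.
- by apply: differentiableD; [exact: dF|exact: dG].
- by apply: differentiableM; [exact: dF|exact: dG].
Qed.

Lemma radial_derive F v : radial_polyfun F ->
  exists2 G, radial_polyfun G & forall x, x != 0 -> is_derive x v F (G x).
Proof.
elim=> {F} [i|c||F1 F2 r1 [G1 s1 d1] r2 [G2 s2 d2]|F1 F2 r1 [G1 s1 d1] r2 [G2 s2 d2]].
- exists (fun=> v 0 i); first exact: radial_cst.
  by move=> x _; exact: der_coord.
- exists (fun=> 0); first exact: radial_cst.
  by move=> x _; exact: derC.
- exists (fun x => - dotv x v * (enorm x)^-1 ^+ 3); last by move=> x x0; exact: der_inv_enorm.
  have -> : (fun x => - dotv x v * (enorm x)^-1 ^+ 3) =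
      (fun x => (\sum_(i < 3) (x 0 i * - v 0 i)) *
        ((enorm x)^-1 * ((enorm x)^-1 * (enorm x)^-1))).
    apply/funext => x; rewrite !exprS mulr1; congr (_ * _).
    by rewrite /dotv -sumrN; apply: eq_bigr => i _; rewrite mulrN.
  apply: radialM; last by do !apply: radialM; exact: radial_inv.
  have rs n (H : 'I_n -> E -> R) : (forall i, radial_polyfun (H i)) ->
      radial_polyfun (fun x => \sum_(i < n) H i x).
    elim: n H => [|n IHn] H rH.
      by under eq_fun do rewrite big_ord0; exact: radial_cst.
    under eq_fun do rewrite big_ord_recl.
    by apply: radialD => //; exact: IHn.
  by apply: rs => i; apply: radialM; [exact: radial_coord|exact: radial_cst].
- exists (fun x => G1 x + G2 x); first exact: radialD.
  by move=> x x0; apply: derD; [exact: d1|exact: d2].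
- exists (fun x => F1 x * G2 x + F2 x * G1 x).
    by apply: radialD; exact: radialM.
  by move=> x x0; apply: derM; [exact: d1|exact: d2].
Qed.

Lemma near_neq0 x : x != 0 -> \forall y \near x, y != 0.
Proof.
move=> x0; apply: (@open_nbhs_nbhs _ x [set y | y != 0]); split=> //.
have -> : [set y : E | y != 0] = ~` [set 0].
  by apply/seteqP; split=> y /= /eqP.
apply/closed_openC/accessible_closed_set1/hausdorff_accessible.
exact: norm_hausdorff.
Qed.

(** A directional derivative is only known away from the origin, so the
    induction is on functions that agree there with a function of the class. *)
Lemma radial_Ck k F G : radial_polyfun G -> (forall x, x != 0 -> F x = G x) ->
  Ck k [set x | x != 0] F.
Proof.
elim: k F G => [|k IHk] F G rG FG.
  move=> x /= x0; apply: differentiable_continuous.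
  apply: near_differentiable (radial_diff rG x0).
  by apply: filterS (near_neq0 x0) => y y0; rewrite FG.
split=> [x /= x0|v].
  apply: near_differentiable (radial_diff rG x0).
  by apply: filterS (near_neq0 x0) => y y0; rewrite FG.
have [H rH dG] := radial_derive v rG.
apply: (IHk _ H rH) => x x0.
have /near_eq_derive-> : \near x, F x = G x.
  by apply: filterS (near_neq0 x0) => y y0; rewrite FG.
by have [_ ->] := dG x x0.
Qed.

Lemma polyfun_sphereC k F : polyfun F -> sphereC k F.
Proof. by move=> /radial_hext rF; apply: radial_Ck rF _. Qed.

End Smooth.

(** * Integrals of functions with an explicit primitive *)

Section Newton.
Variable R : realType.
Implicit Types (f g : R -> R) (a b u v : R).

(** A certificate for the value of an integral, stable under linear operations
    without any integrability side condition. *)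
Definition newton_integral a b f v := continuous f /\
  exists F : R -> R, (forall x, is_derive x (1 : R) F (f x)) /\ F b - F a = v.

Lemma Rintegral_newton a b f v : a < b -> newton_integral a b f v ->
  \int[lebesgue_measure]_(x in `[a, b]) f x = v.
Proof.
move=> ab [fc [F [dF <-]]]; rewrite /Rintegral.
have Fc x : {for x, continuous F} := is_derive_continuous (dF x).
rewrite (@continuous_FTC2 R f F) //.
- exact: continuous_subspaceT.
- split=> [x _||]; first by have [] := dF x.
    exact/cvg_at_right_filter/Fc.
  exact/cvg_at_left_filter/Fc.
- by move=> x _; rewrite derive1E; have [_ ->] := dF x.
Qed.

Lemma newton_ext a b f g v : f =1 g -> newton_integral a b f v ->
  newton_integral a b g v.
Proof. by move=> /funext->. Qed.

Lemma newtonZ a b f v k : newton_integral a b f v ->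
  newton_integral a b (fun x => k * f x) (k * v).
Proof.
move=> [fc [F [dF <-]]]; split; first by move=> x; exact: ctM (ctC k x) (fc x).
exists (fun x => k * F x); split; last by rewrite mulrBr.
by move=> x; apply: (is_derive_eq (derM (derC k _ _) (dF x))); rewrite mulr0 addr0.
Qed.

Lemma newtonD a b f g u v : newton_integral a b f u -> newton_integral a b g v ->
  newton_integral a b (fun x => f x + g x) (u + v).
Proof.
move=> [fc [F [dF <-]]] [gc [G [dG <-]]].
split; first by move=> x; exact: ctD (fc x) (gc x).
exists (fun x => F x + G x); split; last by rewrite opprD addrACA.
by move=> x; exact: derD.
Qed.

Lemma newton_sum a b n (f : 'I_n -> R -> R) (v : 'I_n -> R) :
  (forall i, newton_integral a b (f i) (v i)) ->
  newton_integral a b (fun x => \sum_(i < n) f i x) (\sum_(i < n) v i).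
Proof.
elim: n f v => [|n IHn] f v fv.
  under eq_fun do rewrite big_ord0; rewrite big_ord0.
  split; first by move=> x; exact: cvg_cst.
  by exists (fun=> 0); split; [move=> x; exact: derC|rewrite subrr].
under eq_fun do rewrite big_ord_recl; rewrite big_ord_recl.
by apply: newtonD => //; exact: IHn.
Qed.

Lemma newton_poly a b (P : {poly R}) :
  newton_integral a b (horner P^`()) (P.[b] - P.[a]).
Proof.
split; first exact: continuous_horner.
by exists (horner P); split=> // x; exact: is_derive_poly.
Qed.

Lemma sin_period (x : R) (m : int) : sin (x + m%:~R * (2 * pi)) = sin x.
Proof.
have P n (y : R) : sin (y + n%:R * (2 * pi)) = sin y.
  rewrite (_ : n%:R * (2 * pi) = pi *+ 2 *+ n); last by rewrite -mulrnA -[in RHS]mulr_natl natrM; ring.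
  by rewrite (periodicn (@sinD2pi R)).
case: m => n; first exact: P.
by rewrite NegzE mulrNz mulNr -[in RHS](subrK (n.+1%:R * (2 * pi)) x) P.
Qed.

Lemma newton_cos (m : int) (al : R) :
  newton_integral 0 (2 * pi) (fun x => cos (m%:~R * x + al))
    (if m == 0 then 2 * pi * cos al else 0).
Proof.
have dl x : is_derive x (1 : R) (fun x => m%:~R * x + al) m%:~R.
  apply: is_derive_eq.
  by rewrite addr0 [_%:A]mulr1.
split; first by move=> x; exact: is_derive_continuous (der_comp (is_derive_cos _) (dl x)).
case: eqVneq => [->|m0].
  exists (fun x => x * cos al); split; last by rewrite mul0r subr0.
  move=> x; apply: is_derive_eq.
  by rewrite !mul0r add0r scaler0 add0r [_%:A]mulr1.
have mR : m%:~R != 0 :> R by rewrite intr_eq0.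
exists (fun x => m%:~R^-1 * sin (m%:~R * x + al)); split=> [x|].
  apply: (is_derive_eq (derM (derC _ _ _) (der_comp (is_derive_sin _) (dl x)))).
  by rewrite mulr0 addr0; field.
by rewrite [_ + al]addrC sin_period mulr0 add0r subrr.
Qed.

Lemma newton_sin (m : int) :
  newton_integral 0 (2 * pi) (fun x => sin (m%:~R * x)) 0.
Proof.
have := newton_cos m (- (pi / 2)).
rewrite cosN cos_pihalf mulr0 if_same; apply: newton_ext => x.
by rewrite cosBpihalf.
Qed.

End Newton.

(** * Waves with finitely many longitudinal modes *)

Section Wave.
Variable R : realType.
Local Notation E := 'rV[R]_3.
Implicit Types (p : nat -> {poly R}) (n k : nat) (phi s theta omega c : R).

Definition colat s : R := Num.sqrt (1 - s ^+ 2).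

(** [colat s] is the cosine of the latitude; its powers make the modes smooth at
    the poles, where they are the real parts of (x + i y)^k times polynomials in
    z. *)
Definition wave n p phi s : R :=
  \sum_(k < n) colat s ^+ k * (p k).[s] * cos (k%:R * phi).

Lemma sqr_colat s : -1 <= s <= 1 -> colat s ^+ 2 = 1 - s ^+ 2.
Proof. by move=> s1; rewrite sqr_sqrtr //; nra. Qed.

Lemma colat_gt0 s : -1 < s < 1 -> 0 < colat s.
Proof. by move=> s1; rewrite sqrtr_gt0; nra. Qed.

(** The power of the cosine of the latitude factors out of the derivative, up to
    the singular factor 1 / (1 - s^2) that the Laplacian compensates. *)
Lemma der_colatX k (q : {poly R}) s : -1 < s < 1 ->
  is_derive s (1 : R) (fun s => colat s ^+ k * q.[s])
    (colat s ^+ k * (q^`().[s] - k%:R * s * q.[s] / (1 - s ^+ 2))).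
Proof.
move=> s1; have r0 := colat_gt0 s1.
have r2 : 1 - s ^+ 2 = colat s ^+ 2 by rewrite sqr_colat //; lra.
have d2 : is_derive s (1 : R) (fun s => 1 - s ^+ 2) (- (2 * s)).
  apply: (is_derive_eq (derB (derC _ _ _) (derX 2 (is_derive_id _ _)))).
  by rewrite sub0r mulr1 expr1.
have d1 : is_derive s (1 : R) colat (- s / colat s).
  apply: (is_derive_eq (der_comp (is_derive1_sqrt _) d2)); first by nra.
  by rewrite -/(colat s); field; rewrite gt_eqF.
apply: (is_derive_eq (derM (derX k d1) (is_derive_poly q s))).
rewrite r2; case: k => [|k] /=; first by field; rewrite gt_eqF.
by rewrite exprS; field; rewrite gt_eqF.
Qed.

Lemma der_cos_shift k phi theta : is_derive phi (1 : R)
  (fun phi => cos (k%:R * (phi - theta))) (- (k%:R * sin (k%:R * (phi - theta)))).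
Proof.
have dl := derM (derC k%:R phi 1) (derB (is_derive_id phi (1 : R)) (derC theta phi 1)).
by apply: (is_derive_eq (der_comp (is_derive_cos _) dl)); ring.
Qed.

Lemma der_sin_shift k phi theta : is_derive phi (1 : R)
  (fun phi => sin (k%:R * (phi - theta))) (k%:R * cos (k%:R * (phi - theta))).
Proof.
have dl := derM (derC k%:R phi 1) (derB (is_derive_id phi (1 : R)) (derC theta phi 1)).
by apply: (is_derive_eq (der_comp (is_derive_sin _) dl)); ring.
Qed.

Definition wave_s n p phi s : R :=
  \sum_(k < n) colat s ^+ k * ((p k)^`().[s] - k%:R * s * (p k).[s] / (1 - s ^+ 2))
     * cos (k%:R * phi).

Definition wave_phi n p phi s : R :=
  \sum_(k < n) colat s ^+ k * (p k).[s] * - (k%:R * sin (k%:R * phi)).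

Lemma der_wave_s n p phi s : -1 < s < 1 ->
  is_derive s (1 : R) (wave n p phi) (wave_s n p phi s).
Proof.
move=> s1; rewrite /wave; apply: der_sum => k.
apply: (is_derive_eq (derM (der_colatX k (p k) s1) (derC _ _ _))).
by rewrite mulr0 add0r mulrC.
Qed.

Lemma der_wave_phi n p theta phi s :
  is_derive phi (1 : R) (fun phi => wave n p (phi - theta) s)
    (wave_phi n p (phi - theta) s).
Proof.
rewrite /wave; apply: der_sum => k.
apply: (is_derive_eq (derM (derC _ _ _) (der_cos_shift k phi theta))).
by rewrite mulr0 addr0.
Qed.

(** How the Laplacian acts on the polynomial factor q of r^k q(s) cos (k phi): the
    terms in 1 / (1 - s^2) of its two parts cancel. *)
Definition mode_laplacian k (q : {poly R}) : {poly R} :=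
  (1 - 'X^2) * q^`()^`() - (2 * k.+1)%:R%:P * 'X * q^`() - (k * k.+1)%:R%:P * q.

Definition wave_laplacian p k := mode_laplacian k (p k).

Lemma laplacian_wave n p theta phi s : -1 < s < 1 ->
  laplacian (fun phi s => wave n p (phi - theta) s) phi s =
  wave n (wave_laplacian p) (phi - theta) s.
Proof.
move=> s1; rewrite /laplacian.
pose q k := (1 - 'X^2) * (p k)^`() - k%:R%:P * 'X * p k.
have -> : derive1 (fun s' => (1 - s' ^+ 2) * derive1 (wave n p (phi - theta)) s') s
          = wave_s n q (phi - theta) s.
  rewrite derive1E -(near_eq_derive (f := wave n q (phi - theta))).
    by have [_ ->] := der_wave_s n q (phi - theta) s1.
  have : s \in `]-1, 1[%R by rewrite in_itv.
  move=> /near_in_itvoo; apply: filterS => y; rewrite in_itv /= => y1.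
  rewrite derive1E; have [_ ->] := der_wave_s n p (phi - theta) y1.
  rewrite /wave mulr_sumr; apply: eq_bigr => k _.
  rewrite !(hornerD, hornerN, hornerM, hornerXn, hornerX, hornerC).
  have y2 : 1 - y ^+ 2 != 0 by rewrite gt_eqF //; nra.
  by field.
have -> : derive1n 2 (fun phi' => wave n p (phi' - theta) s) phi =
    \sum_(k < n) colat s ^+ k * (p k).[s] * - (k%:R * (k%:R * cos (k%:R * (phi - theta)))).
  have -> : derive1n 2 (fun phi' => wave n p (phi' - theta) s) =
      derive1 (fun phi' => wave_phi n p (phi' - theta) s).
    rewrite /derive1n /=; congr derive1; apply/funext => y.
    by rewrite derive1E; have [_ ->] := der_wave_phi n p theta y s.
  rewrite derive1E; apply: derive_val; rewrite /wave_phi; apply: der_sum => k.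
  apply: (is_derive_eq (derM (derC _ _ _)
    (derN (derM (derC _ _ _) (der_sin_shift k phi theta))))).
  by rewrite !mulr0 !addr0.
rewrite /wave_s /wave mulr_sumr -big_split /=; apply: eq_bigr => k _.
have -> : deriv (q k) = (1 - 'X^2) * (p k)^`()^`() - 2%:P * 'X * (p k)^`()
    - k%:R%:P * (p k + 'X * (p k)^`()).
  have d1 : deriv (1 : {poly R}) = 0 by rewrite -polyC1 derivC.
  rewrite /q derivB !derivM derivB d1 !(derivC, derivXn, derivX) /= expr1.
  by rewrite mulr2n; ring.
rewrite /wave_laplacian /mode_laplacian /q.
rewrite !(hornerD, hornerN, hornerMn, hornerM, hornerXn, hornerX, hornerC).
have s2 : 1 - s ^+ 2 != 0 by rewrite gt_eqF //; nra.
by rewrite !natrM -(natr1 k); field.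
Qed.

(** The real and imaginary parts of (x + i y)^k. *)
Fixpoint planar_power k (x : E) : R * R :=
  if k is k'.+1 then
    let w := planar_power k' x in
    (x 0 0 * w.1 - x 0 1 * w.2, x 0 0 * w.2 + x 0 1 * w.1)
  else (1, 0).

(** The wave rotated by the angle theta, as a function of the Cartesian
    coordinates, which shows its smoothness at the poles. *)
Definition wave_sphere n p theta (x : E) : R :=
  \sum_(k < n) (p k).[height x] *
    ((planar_power k x).1 * cos (k%:R * theta) + (planar_power k x).2 * sin (k%:R * theta)).

Lemma sphE phi s : [/\ sph phi s 0 0 = colat s * cos phi,
  sph phi s 0 1 = colat s * sin phi & sph phi s 0 ord_max = s].
Proof. by split; rewrite mxE /= /colat. Qed.

Lemma planar_power_sph k phi s : planar_power k (sph phi s) =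
  (colat s ^+ k * cos (k%:R * phi), colat s ^+ k * sin (k%:R * phi)).
Proof.
elim: k => [|k IHk] /=; first by rewrite !expr0 mul0r cos0 sin0 mulr1 mulr0.
have [-> -> _] := sphE phi s; rewrite IHk /= -(natr1 k) mulrDl mul1r cosD sinD exprS.
by congr (_, _); ring.
Qed.

Lemma coord_wave_sphere n p theta phi s :
  Defs.coord (wave_sphere n p theta) phi s = wave n p (phi - theta) s.
Proof.
rewrite /Defs.coord /wave_sphere /wave; apply: eq_bigr => k _.
rewrite planar_power_sph /height; have [_ _ ->] := sphE phi s.
by rewrite mulrBr cosB /=; ring.
Qed.

Lemma polyfun_wave n p theta : polyfun (wave_sphere n p theta).
Proof.
have P k : polyfun (fun x : E => (planar_power k x).1) /\
           polyfun (fun x : E => (planar_power k x).2).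
  elim: k => [|k [P1 P2]] /=; first by split; exact: polyfun_cst.
  split.
    apply: polyfunD; first exact: polyfunM (polyfun_coord _ _) _.
    under eq_fun do rewrite -mulN1r; apply: polyfunM; first exact: polyfun_cst.
    exact: polyfunM (polyfun_coord _ _) _.
  by apply: polyfunD; apply: polyfunM => //; exact: polyfun_coord.
apply: polyfun_sum => k; have [P1 P2] := P k.
apply: polyfunM; first exact/polyfun_horner/polyfun_coord.
by apply: polyfunD; apply: polyfunM => //; exact: polyfun_cst.
Qed.

Lemma wave_mean n p theta s :
  \int[lebesgue_measure]_(phi in `[0, 2 * pi]) wave n.+1 p (phi - theta) s =
  2 * pi * (p 0%N).[s].
Proof.
apply: Rintegral_newton; first by rewrite mulr_gt0 ?pi_gt0.
have {1}-> : 2 * pi * (p 0%N).[s] = \sum_(k < n.+1) (colat s ^+ k * (p k).[s] *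
    (if k%:Z == 0 then 2 * pi * cos (- (k%:R * theta)) else 0)).
  rewrite big_ord_recl /= big1; last by move=> k _; rewrite mulr0.
  by rewrite mul0r oppr0 cos0 expr0; ring.
apply: newton_sum => k; apply: newtonZ.
by apply: newton_ext (newton_cos k%:Z (- (k%:R * theta))) => phi; rewrite mulrBr.
Qed.

(** The derivative in time of the travelling vorticity is -c times the one in
    longitude, so the Euler equation is the vanishing of the Jacobian of the
    stream function and of the absolute vorticity in the frame of the wave.  The
    mean only involves the zonal mode p 0, of which P is a primitive. *)
Lemma wave_travelling n p (P : {poly R}) omega c (Psi : E -> R) :
  (forall phi s, -1 <= s <= 1 -> Defs.coord Psi phi s = wave n.+1 p phi s) ->
  deriv P = p 0%N -> P.[1] = P.[-1] ->
  (forall phi s, -1 < s < 1 ->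
     wave_phi n.+1 p phi s * (wave_s n.+1 (wave_laplacian p) phi s + 2 * omega) =
     (wave_s n.+1 p phi s + c) * wave_phi n.+1 (wave_laplacian p) phi s) ->
  travelling_wave omega Psi c.
Proof.
move=> PsiE dP P11 jac.
pose U t := wave_sphere n.+1 p (c * t).
pose Y t := wave_sphere n.+1 (wave_laplacian p) (c * t).
have UE t : Defs.coord (U t) = fun phi s => wave n.+1 p (phi - c * t) s.
  by apply/funext => phi; apply/funext => s; exact: coord_wave_sphere.
have YE t : Defs.coord (Y t) = fun phi s => wave n.+1 (wave_laplacian p) (phi - c * t) s.
  by apply/funext => phi; apply/funext => s; exact: coord_wave_sphere.
exists U, Y; split; last by move=> t phi s s1; rewrite UE PsiE.
split.
- by move=> t; split; apply: polyfun_sphereC; exact: polyfun_wave.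
- move=> t; rewrite UE /sphere_integral.
  under eq_Rintegral do rewrite wave_mean.
  apply: Rintegral_newton; first lra.
  by have := newtonZ (2 * pi) (newton_poly (-1) 1 P); rewrite dP P11 subrr mulr0.
- by move=> t phi s s1; rewrite UE YE laplacian_wave.
- move=> t phi s s1 absvort.
  have dt : is_derive t (1 : R) (fun t' => Defs.coord (Y t') phi s)
      (- c * wave_phi n.+1 (wave_laplacian p) (phi - c * t) s).
    have dl := derB (derC phi t 1) (derM (derC c t 1) (is_derive_id t (1 : R))).
    have dw : is_derive (phi - c * t) (1 : R)
        (fun phi => wave n.+1 (wave_laplacian p) phi s)
        (wave_phi n.+1 (wave_laplacian p) (phi - c * t) s).
      have := der_wave_phi n.+1 (wave_laplacian p) 0 (phi - c * t) s.
      rewrite subr0; congr is_derive; apply/funext => u; by rewrite subr0.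
    have -> : (fun t' => Defs.coord (Y t') phi s) =
        (fun t' => wave n.+1 (wave_laplacian p) (phi - c * t') s).
      by apply/funext => u; rewrite YE.
    by apply: (is_derive_eq (der_comp (f := fun t => phi - c * t) dw dl)); ring.
  split; first by have [] := dt.
  have dUs := der_wave_s n.+1 p (phi - c * t) s1.
  have dUphi := der_wave_phi n.+1 p (c * t) phi s.
  have dAs := derD (der_wave_s n.+1 (wave_laplacian p) (phi - c * t) s1)
    (derM (derC (2 * omega) s 1) (is_derive_id s (1 : R))).
  have dAphi := derD (der_wave_phi n.+1 (wave_laplacian p) (c * t) phi s)
    (derC (2 * omega * s) phi 1).
  rewrite !derive1E; have [_ ->] := dt.
  rewrite /absvort UE YE.
  have [_ ->] := dUs; have [_ ->] := dUphi; have [_ ->] := dAs; have [_ ->] := dAphi.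
  have := jac (phi - c * t) s s1.
  by rewrite mulr0 !addr0 mulr1 => ->; ring.
Qed.

End Wave.

(** * Spherical harmonic coefficients of waves of degree at most three *)

Section Rodrigues.
Variable R : realType.
Implicit Types (f g q : {poly R}) (x : R).

(** Each derivative lowers the multiplicity of a root by at most one. *)
Lemma derivn_root x k b g :
  ('X - x%:P) ^+ k %| g -> (b < k)%N -> (derivn b g).[x] = 0.
Proof.
elim: b k g => [|b IHb] [|k] g // /dvdpP[h ->] bk.
  by rewrite derivn0 exprS !(hornerM, hornerXsubC) subrr mul0r mulr0.
rewrite derivSn; apply: (IHb k) => //.
rewrite derivM deriv_exp derivXsubC mul1r /= -mulr_natr.
by apply: dvdp_add; [rewrite exprS mulrA dvdp_mulIr|rewrite mulrCA dvdp_mulIl].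
Qed.

(** Integration by parts n times; the boundary terms are gathered in B, which
    vanishes where all the products of derivatives of total order n - 1 do. *)
Lemma repeated_parts n f g :
  exists B : {poly R}, deriv B = f * derivn n g - (-1) ^+ n *: (derivn n f * g) /\
    forall x, (forall a, (a < n)%N -> (derivn a f).[x] * (derivn (n.-1 - a) g).[x] = 0) ->
      B.[x] = 0.
Proof.
elim: n f => [|n IHn] f.
  by exists 0; split=> [|x _]; rewrite ?horner0 // deriv0 !derivn0 expr0 scale1r subrr.
have [B [dB B0]] := IHn (deriv f).
exists (f * derivn n g - B); split.
  by rewrite derivB derivM dB -derivnS -derivSn exprS mulN1r scaleNr; ring.
move=> x fg0; rewrite hornerD hornerN hornerM B0.
  by have := fg0 0%N isT; rewrite derivn0 subn0 => ->; rewrite subrr.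
move=> a an; have := fg0 a.+1 an.
by rewrite derivSn -predn_sub -subnS; case: n an {IHn dB B0 fg0} => // n an; rewrite subSS.
Qed.

(** At 1 and -1 the factor (1 - s^2)^m kills the derivatives of order less than m
    of the first factor and (s^2 - 1)^l those of order less than l of the second,
    so all boundary terms vanish; the remaining integral has a derivative of order
    l + m of a polynomial of smaller degree. *)
Lemma rodrigues_orthogonal l m q : (size q + m <= l)%N ->
  newton_integral (-1) 1
    (horner ((1 - 'X^2) ^+ m * q * derivn (l + m) (('X^2 - 1) ^+ l))) 0.
Proof.
move=> ql; set f := (1 - 'X^2) ^+ m * q; set g := ('X^2 - 1) ^+ l.
have [B [dB B0]] := repeated_parts (l + m) f g.
have f0 : derivn (l + m) f = 0.
  apply: derivn_poly0; rewrite /f.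
  have s2 : (size (1 - 'X^2 : {poly R})%R <= 3)%N.
    by rewrite (leq_trans (size_polyD _ _)) // size_polyN size_polyXn size_poly1.
  have := size_polyMleq ((1 - 'X^2) ^+ m) q. have := size_poly_exp_leq (1 - 'X^2 : {poly R}) m.
  have : ((size (1 - 'X^2 : {poly R})%R).-1 * m <= 2 * m)%N by rewrite leq_mul2r; lia.
  move=> h1 /leq_trans -/(_ (2 * m).+1 h1) h2 /leq_trans; apply.
  have E a b : (a <= (2 * m).+1 -> b + m <= l -> (a + b).-1 <= l + m)%N by lia.
  exact: E h2 ql.
have {}dB : deriv B = f * derivn (l + m) g by rewrite dB f0 mul0r scaler0 subr0.
have Bx x : x = 1 \/ x = -1 -> B.[x] = 0.
  move=> x1; apply: B0 => a alm.
  have dX : 'X - x%:P %| 'X^2 - 1.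
    rewrite dvdp_XsubCl rootE !hornerE; case: x1 => ->; by rewrite ?sqrrN expr1n subrr.
  have [am|ma] := ltnP a m.
    rewrite (@derivn_root x m) ?mul0r // /f dvdp_mulr //.
    by apply: dvdp_exp2r; rewrite -(opprB _ 1) dvdpNr.
  rewrite (@derivn_root x l _ g) ?mulr0 ?dvdp_exp2r //.
  lia.
by have := newton_poly (-1) 1 B; rewrite dB !Bx ?subrr; auto.
Qed.

Definition primitive q : {poly R} := \poly_(i < (size q).+1) (q`_i.-1 / i%:R).

Lemma deriv_primitive q : deriv (primitive q) = q.
Proof.
apply/polyP => i; rewrite coef_deriv coef_poly /= ltnS.
case: ltnP => [_|qi]; last by rewrite mul0rn nth_default.
by rewrite -(mulr_natr (_ / _)) divfK // pnatr_eq0.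
Qed.

Lemma newton_primitive q : newton_integral (-1) 1 (horner q)
  ((primitive q).[1] - (primitive q).[-1]).
Proof. by rewrite -{1}(deriv_primitive q); exact: newton_poly. Qed.

End Rodrigues.

Section Coefficients.
Variable R : realType.
Local Notation E := 'rV[R]_3.
Implicit Types (p : nat -> {poly R}) (l k : nat) (m : int).

Lemma newton_cos_cos k m :
  newton_integral 0 (2 * pi) (fun x : R => cos (k%:R * x) * cos (m%:~R * x))
    (pi * ((k%:Z - m == 0)%:R + (k%:Z + m == 0)%:R)).
Proof.
have := newtonD (newtonZ (1 / 2) (newton_cos (k%:Z - m) (0 : R)))
  (newtonZ (1 / 2) (newton_cos (k%:Z + m) (0 : R))).
rewrite cos0 => H.
have -> : pi * ((k%:Z - m == 0)%:R + (k%:Z + m == 0)%:R) =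
   1 / 2 * (if k%:Z - m == 0 then 2 * pi * 1 else 0) +
   1 / 2 * (if k%:Z + m == 0 then 2 * pi * 1 else 0) :> R.
  by case: (_ - _ == 0); case: (_ + _ == 0) => /=; field.
apply: newton_ext H => x; rewrite !addr0 intrB intrD -[k%:Z%:~R]/(k%:R) mulrBl mulrDl cosB cosD.
by field.
Qed.

Lemma newton_cos_sin k m :
  newton_integral 0 (2 * pi) (fun x : R => cos (k%:R * x) * sin (m%:~R * x)) 0.
Proof.
have := newtonD (newtonZ (1 / 2) (newton_sin R (k%:Z + m)))
  (newtonZ (- (1 / 2)) (newton_sin R (k%:Z - m))).
rewrite !mulr0 addr0; apply: newton_ext => x.
by rewrite intrB intrD -[k%:Z%:~R]/(k%:R) mulrBl mulrDl sinB sinD; field.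
Qed.

(** The integral in longitude keeps the mode k = |m| only, for which the square
    roots r^k of the wave and r^|m| of Y_l^m multiply to (1 - s^2)^|m|.  This is the
    constant left in front of the integral of a polynomial in s. *)
Definition coef_factor l m : R :=
  Num.sqrt ((2 * l + 1)%:R / (4 * pi) * ((l - `|m|)`!%:R / (l + `|m|)`!%:R))
  / (2 ^+ l * l`!%:R)
  * (pi * ((`|m|%N%:Z - m == 0)%:R + (`|m|%N%:Z + m == 0)%:R)).

Definition coef_poly_factor l m : {poly R} :=
  derivn (l + `|m|) (('X^2 - 1) ^+ l).

Lemma sphYE l m phi s : sphY l m phi s =
  (Num.sqrt ((2 * l + 1)%:R / (4 * pi) * ((l - `|m|)`!%:R / (l + `|m|)`!%:R))
    * legendre l `|m| s * cos (m%:~R * phi) +i*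
   (Num.sqrt ((2 * l + 1)%:R / (4 * pi) * ((l - `|m|)`!%:R / (l + `|m|)`!%:R))
    * legendre l `|m| s * sin (m%:~R * phi)) :> R[i])%C.
Proof. by rewrite /sphY; congr (_ +i* _)%C; rewrite mul0r ?subr0 ?addr0. Qed.

Lemma sph_coef_wave (F : E -> R) p l m v :
  (forall phi s, -1 <= s <= 1 -> Defs.coord F phi s = wave 4 p phi s) ->
  (forall k, (size (p k) <= 4 - k)%N) ->
  newton_integral (-1) 1
    (horner ((1 - 'X^2) ^+ `|m| * p `|m|%N * coef_poly_factor l m)) v ->
  sph_coef F l m = (coef_factor l m * v -i* 0)%C.
Proof.
move=> FE sz vE; rewrite /sph_coef.
have s1 : forall s : R, s \in `[-1, 1] -> -1 <= s <= 1.
  by move=> s; rewrite inE /= in_itv.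
have pi20 : (0 : R) < 2 * pi by rewrite mulr_gt0 ?pi_gt0.
have e2 : \int[lebesgue_measure]_(s in `[(-1 : R), 1]) 0 = (0 : R).
  by rewrite /Rintegral integral0.
congr (_ -i* _)%C; last first.
  rewrite /sphere_integral -[RHS]e2; apply: eq_Rintegral => s /s1 s11.
  under eq_Rintegral do rewrite FE // sphYE /= /wave mulr_suml.
  apply: Rintegral_newton => //.
  pose N := Num.sqrt ((2 * l + 1)%:R / (4 * pi) * ((l - `|m|)`!%:R / (l + `|m|)`!%:R)) : R.
  rewrite [X in newton_integral _ _ _ X](_ : _ = \sum_(k < 4) (colat s ^+ k * (p k).[s] * (N * legendre l `|m| s) * 0)); last first.
    by rewrite big1 // => k _; rewrite mulr0.
  apply: newton_sum => k.
  apply: newton_ext (newtonZ _ (newton_cos_sin k m)) => phi.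
  by rewrite /N; ring.
pose N := Num.sqrt ((2 * l + 1)%:R / (4 * pi) * ((l - `|m|)`!%:R / (l + `|m|)`!%:R)) : R.
pose kap k : R := pi * ((k%:Z - m == 0)%:R + (k%:Z + m == 0)%:R).
have kap0 k : k != `|m|%N -> kap k = 0.
  move=> km; rewrite /kap.
  have /negPf-> : k%:Z - m != 0 by apply: contra km => /eqP H; apply/eqP; lia.
  have /negPf-> : k%:Z + m != 0 by apply: contra km => /eqP H; apply/eqP; lia.
  by rewrite addr0 mulr0.
rewrite /sphere_integral.
transitivity (\int[lebesgue_measure]_(s in `[-1, 1])
    (coef_factor l m * ((1 - 'X^2) ^+ `|m| * p `|m|%N * coef_poly_factor l m).[s])).
  apply: eq_Rintegral => s /s1 s11.
  under eq_Rintegral do rewrite FE // sphYE /= /wave mulr_suml.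
  apply: Rintegral_newton => //.
  rewrite [X in newton_integral _ _ _ X](_ : _ =
    \sum_(k < 4) (colat s ^+ k * (p k).[s] * (N * legendre l `|m| s) * kap k)).
    apply: newton_sum => k.
    apply: newton_ext (newtonZ _ (newton_cos_cos k m)) => phi.
    by rewrite /N; ring.
  have [m4|m4] := ltnP `|m| 4; last first.
    rewrite big1 => [|k _]; last by rewrite kap0 ?mulr0 // ltn_eqF // (leq_trans _ m4).
    have := sz `|m|%N; rewrite (eqP (_ : (4 - `|m|)%N == 0%N)) ?subn_eq0 //.
    by rewrite leqn0 size_poly_eq0 => /eqP->; rewrite mulr0 mul0r horner0 mulr0.
  rewrite (bigD1 (Ordinal m4)) //= big1 ?addr0 => [|k km]; last first.
    by rewrite kap0 ?mulr0.
  rewrite /coef_factor -/N -/(kap `|m|%N) /legendre -/(colat s) -/(coef_poly_factor l m).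
  rewrite !hornerM horner_exp !(hornerD, hornerN, hornerXn, hornerC) -sqr_colat //.
  rewrite -exprM mulnC exprM.
  by ring.
by apply: Rintegral_newton; [lra|exact: newtonZ].
Qed.

Lemma normc_real (a : R) : Normc.normc (a -i* 0)%C = `|a|.
Proof. by rewrite /= oppr0 expr0n addr0 sqrtr_sqr. Qed.

Definition wave_coefs_le (F : E -> R) (eta : R) := exists p,
  [/\ forall phi s, -1 <= s <= 1 -> Defs.coord F phi s = wave 4 p phi s,
      forall k, (size (p k) <= 4 - k)%N
    & forall k j, `|(p k)`_j| <= eta].

(** The coefficient is linear in the finitely many coefficients of the wave. *)
Lemma sph_coef_bound l m : exists2 C : R, 0 <= C & forall (F : E -> R) eta,
  wave_coefs_le F eta -> Normc.normc (sph_coef F l m) <= C * eta.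
Proof.
pose W j := (1 - 'X^2) ^+ `|m| * 'X^j * coef_poly_factor l m.
pose I j : R := (primitive (W j)).[1] - (primitive (W j)).[-1].
exists (`|coef_factor l m| * \sum_(j < 4) `|I j|).
  by rewrite mulr_ge0 // sumr_ge0.
move=> F eta [p [FE sz small]].
have vE : newton_integral (-1) 1
    (horner ((1 - 'X^2) ^+ `|m| * p `|m|%N * coef_poly_factor l m))
    (\sum_(j < 4) (p `|m|%N)`_j * I j).
  have := newton_sum (fun j : 'I_4 => newtonZ (p `|m|%N)`_j (newton_primitive (W j))).
  apply: newton_ext => s; rewrite !hornerM (@horner_coef_wide _ 4 (p _)).
    rewrite mulr_sumr mulr_suml; apply: eq_bigr => j _.
    by rewrite !hornerM hornerXn; ring.
  by rewrite (leq_trans (sz _)) // leq_subr.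
rewrite (sph_coef_wave FE sz vE) normc_real normrM -mulrA ler_wpM2l //.
rewrite (le_trans (ler_norm_sum _ _ _)) // mulr_suml ler_sum // => j _.
by rewrite normrM mulrC ler_wpM2l.
Qed.

Lemma sph_coef_high (F : E -> R) eta l m : wave_coefs_le F eta ->
  (4 <= l)%N -> (`|m| <= l)%N -> Normc.normc (sph_coef F l m) = 0.
Proof.
move=> [p [FE sz _]] l4 ml.
have vE : newton_integral (-1) 1
    (horner ((1 - 'X^2) ^+ `|m| * p `|m|%N * coef_poly_factor l m)) 0.
  by apply: rodrigues_orthogonal; have := sz `|m|%N; lia.
by rewrite (sph_coef_wave FE sz vE) normc_real mulr0 normr0.
Qed.

Lemma sph_energy_bound l : exists2 C : R, 0 <= C & forall (F : E -> R) eta,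
  wave_coefs_le F eta -> sph_energy F l <= C * eta ^+ 2.
Proof.
have [C C0] : exists2 C : 'I_l.*2.+1 -> R, forall j, 0 <= C j &
    forall (j : 'I_l.*2.+1) F eta, wave_coefs_le F eta ->
      Normc.normc (sph_coef F l (j%:Z - l%:Z)) <= C j * eta.
  exists (fun j : 'I_l.*2.+1 => s2val (cid2 (sph_coef_bound l (j%:Z - l%:Z)))).
    by move=> j; case: cid2.
  by move=> j; case: cid2.
move=> CE; exists (\sum_j C j ^+ 2); first by apply: sumr_ge0 => j _; rewrite sqr_ge0.
move=> F eta Feta; rewrite mulr_suml; apply: ler_sum => j _.
by rewrite -exprMn lerXn2r ?nnegrE ?(le_trans _ (CE j F eta Feta)) ?CE //;
  case: (sph_coef _ _ _) => a b /=; rewrite sqrtr_ge0.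
Qed.

Lemma sph_energy_high (F : E -> R) eta l : wave_coefs_le F eta ->
  (4 <= l)%N -> sph_energy F l = 0.
Proof.
move=> Feta l4; rewrite /sph_energy big1 // => j _.
by rewrite (sph_coef_high Feta) ?expr0n //; have := ltn_ord j; lia.
Qed.

(** Since only the degrees l < 4 contribute, the weights are arbitrary: this
    covers the analytic norms and the Sobolev norms at once. *)
Lemma weighted_norm_small (w : nat -> R) (eps : R) : 0 < eps ->
  exists2 eta : R, 0 < eta & forall F : E -> R, wave_coefs_le F eta ->
    (sqrte (\sum_(0 <= l <oo) (w l * sph_energy F l)%:E) < eps%:E)%E.
Proof.
move=> eps0.
pose C l : R := s2val (cid2 (sph_energy_bound l)).
have C0 l : 0 <= C l by rewrite /C; case: cid2.
have CE l F eta : wave_coefs_le F eta -> sph_energy F l <= C l * eta ^+ 2.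
  by rewrite /C; case: cid2 => c c0 /= H /H.
pose K := \sum_(l < 4) `|w l| * C l.
have K0 : 0 <= K by apply: sumr_ge0 => l _; rewrite mulr_ge0.
exists (eps / (K + 1)); first by rewrite divr_gt0 // ltr_wpDl.
move=> F Feta.
have -> : (\sum_(0 <= l <oo) (w l * sph_energy F l)%:E =
    (\sum_(l < 4) w l * sph_energy F l)%:E)%E.
  apply: lim_near_cst => //.
  exists 4%N => //= n n4.
  rewrite sumEFin (big_cat_nat (leq0n 4) n4) /= [X in _ + X]big1_seq ?addr0.
    by rewrite big_mkord.
  move=> l /andP[_]; rewrite mem_index_iota => /andP[l4 _].
  by rewrite (sph_energy_high Feta) ?mulr0.
rewrite /= lte_fin.
rewrite -[ltRHS]ger0_norm ?(ltW eps0) // -sqrtr_sqr ltr_sqrt ?exprn_gt0 //.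
have le : \sum_(l < 4) w l * sph_energy F l <= K * (eps / (K + 1)) ^+ 2.
  rewrite mulr_suml ler_sum // => l _.
  have e0 : 0 <= sph_energy F l by apply: sumr_ge0 => j _; rewrite sqr_ge0.
  rewrite -mulrA (le_trans (ler_wpM2r e0 (ler_norm (w l)))) //.
  by rewrite ler_wpM2l // CE.
apply: (le_lt_trans le).
rewrite expr_div_n mulrA ltr_pdivrMr; last by nra.
rewrite mulrC ltr_pM2l ?exprn_gt0 //; nra.
Qed.

End Coefficients.

(** * Curves on the sphere *)

Section Curves.
Variable R : realType.
Local Notation E := 'rV[R]_3.
Implicit Types (x y p q v : E).

Definition vec3 (a b c : R) : E := \row_(i < 3) [:: a; b; c]`_i.

Lemma vec3E a b c : [/\ vec3 a b c 0 0 = a, vec3 a b c 0 1 = b & vec3 a b c 0 ord_max = c].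
Proof. by split; rewrite mxE. Qed.

Lemma eq_vec3 x y : x 0 0 = y 0 0 -> x 0 1 = y 0 1 -> x 0 ord_max = y 0 ord_max -> x = y.
Proof.
move=> e0 e1 e2; apply/rowP => i.
case: (unliftP ord_max i) => [j ->|->] //.
case: (unliftP ord_max j) => [k ->|->] //.
  rewrite (_ : lift _ _ = 0) //; apply/val_inj => /=.
  by have := ltn_ord k; rewrite /bump; case: (k : nat).
by rewrite (_ : lift _ _ = 1) //; apply/val_inj.
Qed.

Lemma dotvE x y : dotv x y = x 0 0 * y 0 0 + x 0 1 * y 0 1 + x 0 ord_max * y 0 ord_max.
Proof.
rewrite /dotv !big_ord_recl big_ord0 addr0 addrA.
by congr (_ * _ + _ * _ + _ * _); congr (_ _ _); apply/val_inj.
Qed.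

Lemma sphereP x : sphere x <-> x 0 0 ^+ 2 + x 0 1 ^+ 2 + x 0 ord_max ^+ 2 = 1.
Proof.
rewrite /sphere /enorm /= dotvE -!expr2; split=> [H|->]; last by rewrite sqrtr1.
by rewrite -[LHS]sqr_sqrtr ?H ?expr1n // !addr_ge0 // sqr_ge0.
Qed.

Lemma continuous_coord (i : 'I_3) : continuous (fun x : E => x 0 i).
Proof. exact: coord_continuous. Qed.

Lemma ct_vec3 (T : topologicalType) (f g h : T -> R) (t : T) :
  {for t, continuous f} -> {for t, continuous g} -> {for t, continuous h} ->
  {for t, continuous (fun t => vec3 (f t) (g t) (h t))}.
Proof.
have vE a b c : vec3 a b c = a *: vec3 1 0 0 + b *: vec3 0 1 0 + c *: vec3 0 0 1.
  apply: eq_vec3; rewrite !mxE /=; ring.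
move=> fc gc hc; rewrite /prop_for /continuous_at vE.
have -> : (fun t => vec3 (f t) (g t) (h t)) =
    (fun t => f t *: vec3 1 0 0 + g t *: vec3 0 1 0 + h t *: vec3 0 0 1).
  by apply/funext => u; exact: vE.
by apply: cvgD; [apply: cvgD|]; apply: cvgZr_tmp; [exact: fc|exact: gc|exact: hc].
Qed.

(** The way all separation properties and all upper bounds of connected components
    are proved: a connected set cannot cross a level that it does not meet. *)
Lemma connected_IVT (T : topologicalType) (K : set T) (f : T -> R) (x y : T) (v : R) :
  connected K -> continuous f -> K x -> K y -> f x <= v <= f y ->
  exists2 z, K z & f z = v.
Proof.
move=> Kc fc Kx Ky xvy.
have /connected_intervalP fK : connected (f @` K).
  by apply: connected_continuous_connected => //; exact: continuous_subspaceT.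
have [z Kz fz] : (f @` K) v by apply: fK xvy; [exists x|exists y].
by exists z.
Qed.

Lemma cos_eq1 (t : R) : cos t = 1 -> `|t| < 2 * pi -> t = 0.
Proof.
move=> c1 tp.
have s0 : sin (t / 2) = 0.
  have := cos_mulr2n (t / 2); rewrite (_ : t / 2 *+ 2 = t) ?c1 ?cos2sin2 => [H|]; last by rewrite mulr2n; lra.
  by apply/eqP; rewrite -sqrf_eq0; apply/eqP; move: H; rewrite mulr2n; lra.
case: (ltrgtP t 0) => // t0.
  have : 0 < sin (- (t / 2)) by apply: sin_gt0_pi; rewrite ltr0_norm in tp; lra.
  by rewrite sinN s0 oppr0 ltxx.
have : 0 < sin (t / 2) by apply: sin_gt0_pi; rewrite gtr0_norm in tp; lra.
by rewrite s0 ltxx.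
Qed.

Lemma angle_inj (t u : R) : cos t = cos u -> sin t = sin u -> `|t - u| < 2 * pi -> t = u.
Proof.
move=> ct st tu; apply/eqP; rewrite -subr_eq0; apply/eqP; apply: cos_eq1 tu.
by rewrite cosB ct st -!expr2 cos2Dsin2.
Qed.

Lemma angle_exists (u v : R) : u ^+ 2 + v ^+ 2 = 1 ->
  exists t : R, [/\ 0 <= t < 2 * pi, cos t = u & sin t = v].
Proof.
move=> uv1.
have u1 : -1 <= u <= 1 by nra.
have [[t0 tp] ct] : (0 <= acos u /\ acos u <= pi) /\ cos (acos u) = u.
  by have [/andP[-> ->]] := acos_def u1.
have st : sin (acos u) = `|v|.
  by rewrite sin_acos // -sqrtr_sqr; congr Num.sqrt; lra.
have p0 := pi_gt0 R.
case: (lerP 0 v) => v0.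
  exists (acos u); split=> //; first lra.
  by rewrite st ger0_norm.
have tN : acos u != 0.
  by apply: contraTneq v0 => a0; move: st; rewrite a0 sin0 => /esym/eqP;
    rewrite normr_eq0 => /eqP->; rewrite ltxx.
exists (2 * pi - acos u); split.
- have : 0 < acos u by rewrite lt_def tN. by lra.
- by rewrite mulr_natl cosB cos2pi sin2pi mul1r mul0r addr0.
- by rewrite mulr_natl sinB cos2pi sin2pi mul0r sub0r mul1r st ltr0_norm ?opprK.
Qed.

(** All loops below are parametrized by an angle; injectivity is asked in terms of
    its cosine and sine, which is what the formulas for the curves give. *)
Lemma simple_loop_angle (g : R -> E) (C : set E) :
  continuous g -> (forall t, g (t + 2 * pi) = g t) ->
  (forall t u, g t = g u -> cos t = cos u /\ sin t = sin u) ->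
  (forall y, C y <-> exists2 t : R, 0 <= t < 2 * pi & g t = y) ->
  simple_loop (fun a => g (2 * pi * a)) C.
Proof.
move=> gc gp gi gC; have p0 := pi_gt0 R.
split.
- apply: continuous_subspaceT => a.
  have ca : {for a, continuous (fun a : R => 2 * pi * a)}.
    by apply: ctM; [exact: ctC|exact: cvg_id].
  exact: continuous_comp ca (gc _).
- by rewrite mulr0 mulr1 -[in RHS](add0r (2 * pi)) gp.
- move=> a b; rewrite !inE /= !in_itv /= => a01 b01 /gi[cab sab].
  have := angle_inj cab sab; rewrite -mulrBr normrM gtr0_norm ?mulr_gt0 //.
  rewrite gtr_pMr ?mulr_gt0 // => H.
  have /H/mulfI-> // : `|a - b| < 1 by rewrite ltr_norml; lra.
  by rewrite mulf_neq0 // gt_eqF.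
- apply/seteqP; split=> [y [a]|y].
    rewrite /= in_itv /= => a01 <-.
    have [a1|a1] := eqVneq a 1.
      apply/gC; exists 0; first by rewrite lexx mulr_gt0.
      by rewrite a1 mulr1 -[in RHS](add0r (2 * pi)) gp.
    apply/gC; exists (2 * pi * a) => //.
    have {}a1 : a < 1 by rewrite lt_neqAle a1; case/andP: a01.
    have [a0 _] := andP a01.
    by rewrite !mulr_ge0 ?(ltW p0) //= gtr_pMr ?mulr_gt0.
  move=> /gC[t t0 <-]; exists (t / (2 * pi)); last by rewrite mulrC divfK // mulf_neq0 // gt_eqF.
  rewrite /= in_itv /=; have [t1 t2] := andP t0.
  by rewrite divr_ge0 ?mulr_ge0 ?(ltW p0) //= ler_pdivrMr ?mul1r ?(ltW t2) // mulr_gt0.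
Qed.

Lemma simple_loop_connected (g : R -> E) C : simple_loop g C -> connected C.
Proof.
by move=> [gc _ _ <-]; apply: connected_continuous_connected gc; exact: segment_connected.
Qed.

(** On the sphere the degree 0 extension differentiates along the tangential part
    of v. *)
Lemma der_hext_coord (i : 'I_3) p v : sphere p ->
  is_derive p v (fun x : E => ((enorm x)^-1 *: x) 0 i) (v 0 i - dotv p v * p 0 i).
Proof.
move=> p1; have p0 : p != 0.
  apply: contraPneq p1 => ->; apply/eqP.
  by rewrite /enorm /dotv big1 ?sqrtr0 1?eq_sym ?oner_eq0 // => j _; rewrite mxE mul0r.
under eq_fun do rewrite mxE.
apply: (is_derive_eq (derM (der_inv_enorm v p0) (der_coord i p v))).
by rewrite (p1 : enorm p = 1) invr1; ring.
Qed.

End Curves.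

(** * Waves of degree at most three *)

Section Cubic.
Variable R : realType.
Local Notation E := 'rV[R]_3.
Implicit Types (a b c d e g omega phi s : R).

(** The modes of all waves below: the degrees of the polynomials are those for
    which r^k q(s) cos (k phi) is a polynomial of degree at most three. *)
Definition cubic_modes a b c d e g (k : nat) : {poly R} :=
  match k with
  | 0%N => a *: 'X^3 + b *: 'X
  | 1%N => c *: 'X^2 + d%:P
  | 2%N => e *: 'X
  | 3%N => g%:P
  | _ => 0
  end.

Lemma wave_cubic a b c d e g phi s :
  wave 4 (cubic_modes a b c d e g) phi s =
  a * s ^+ 3 + b * s + colat s * (c * s ^+ 2 + d) * cos phi
  + colat s ^+ 2 * (e * s) * cos (2 * phi) + colat s ^+ 3 * g * cos (3 * phi).
Proof.
rewrite /wave !big_ord_recr big_ord0 /= mul0r cos0 expr0 expr1 mul1r.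
by rewrite !(hornerD, hornerZ, hornerXn, hornerX, hornerC) (mul1r phi); ring.
Qed.

(** The harmonics of degree three have the eigenvalue -12; the deviations in the
    second and fourth coefficients come from those of degree one. *)
Lemma laplacian_cubic a b c d e g :
  wave_laplacian (cubic_modes a b c d e g) =
  cubic_modes (- 12 * a) (6 * a - 2 * b) (- 12 * c) (2 * c - 2 * d) (- 12 * e) (- 12 * g).
Proof.
apply/funext => -[|[|[|[|k]]]]; rewrite /wave_laplacian /mode_laplacian /=.
- rewrite !(derivD, derivZ, derivXn, derivX, derivMn, derivC, deriv0) /= -!mul_polyC; ring.
- rewrite !(derivD, derivZ, derivXn, derivX, derivMn, derivC, deriv0) /= -!mul_polyC; ring.
- rewrite !(derivD, derivZ, derivXn, derivX, derivMn, derivC, deriv0) /= -!mul_polyC; ring.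
- rewrite !derivC; ring.
- by rewrite !deriv0 !mulr0 !subr0.
Qed.

Lemma size_cubic a b c d e g k : (size (cubic_modes a b c d e g k) <= 4 - k)%N.
Proof.
have sZ x n : (size (x *: 'X^n : {poly R})%R <= n.+1)%N.
  by rewrite (leq_trans (size_scale_leq _ _)) // size_polyXn.
case: k => [|[|[|[|k]]]] /=.
- by rewrite (leq_trans (size_polyD _ _)) // geq_max sZ (leq_trans (sZ _ 1%N)).
- by rewrite (leq_trans (size_polyD _ _)) // geq_max sZ (leq_trans (size_polyC_leq1 _)).
- exact: (sZ _ 1%N).
- exact: size_polyC_leq1.
- by rewrite size_poly0.
Qed.

Lemma coef_cubic a b c d e g eta k j :
  0 <= eta -> `|a| <= eta -> `|b| <= eta -> `|c| <= eta -> `|d| <= eta ->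
  `|e| <= eta -> `|g| <= eta -> `|(cubic_modes a b c d e g k)`_j| <= eta.
Proof.
move=> eta0 ae be ce de ee ge.
case: k => [|[|[|[|k]]]] /=; rewrite ?(coefD, coefZ, coefXn, coefX, coefC, coef0) ?normr0 //;
  by case: j => [|[|[|[|j]]]] /=; rewrite ?(mulr0, mulr1, addr0, add0r, normr0).
Qed.

Lemma cubic_travelling a b c d e g omega v (Psi : E -> R) :
  (forall phi s, -1 <= s <= 1 ->
     Defs.coord Psi phi s = wave 4 (cubic_modes a b c d e g) phi s) ->
  (forall phi s, -1 < s < 1 ->
     let p := cubic_modes a b c d e g in
     wave_phi 4 p phi s * (wave_s 4 (wave_laplacian p) phi s + 2 * omega) =
     (wave_s 4 p phi s + v) * wave_phi 4 (wave_laplacian p) phi s) ->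
  travelling_wave omega Psi v.
Proof.
move=> PsiE jac; apply: (wave_travelling (P := (a / 4) *: 'X^4 + (b / 2) *: 'X^2) PsiE) => //.
  have scalerK (x : R) n (q : {poly R}) : (x / n.+1%:R) *: (q *+ n.+1) = x *: q.
    by rewrite -(scaler_nat _ q) scalerA divfK ?pnatr_eq0.
  by rewrite derivD !derivZ !derivXn /= !scalerK.
by rewrite !(hornerD, hornerZ, hornerXn); ring.
Qed.

Lemma wave_coefs_le_cubic (F : E -> R) a b c d e g eta : 0 <= eta ->
  (forall phi s, -1 <= s <= 1 ->
     Defs.coord F phi s = wave 4 (cubic_modes a b c d e g) phi s) ->
  `|a| <= eta -> `|b| <= eta -> `|c| <= eta -> `|d| <= eta ->
  `|e| <= eta -> `|g| <= eta -> wave_coefs_le F eta.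
Proof.
move=> eta0 FE ae be ce de ee ge; exists (cubic_modes a b c d e g); split=> //.
  exact: size_cubic.
by move=> k j; exact: coef_cubic.
Qed.

End Cubic.

(** * Tilted zonal flows *)

Section Tilt.
Variables (R : realType) (sg nu : R).
Hypothesis sgnu : sg ^+ 2 + nu ^+ 2 = 1.
Local Notation E := 'rV[R]_3.
Implicit Types (a b phi s omega : R) (x y p q v : E).

(** The sine of the latitude with respect to the axis (sg, 0, nu). *)
Definition axial x : R := sg * x 0 0 + nu * x 0 ord_max.

Let zeta phi s := wave 4 (cubic_modes 0 nu 0 sg 0 0) phi s.

Let zetaE phi s : zeta phi s = sg * (colat s * cos phi) + nu * s.
Proof. by rewrite /zeta wave_cubic; ring. Qed.

Lemma axial_sph phi s : axial (sph phi s) = zeta phi s.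
Proof. by rewrite /axial; have [-> _ ->] := sphE phi s; rewrite zetaE. Qed.

(* the modes of a zeta^3 + b zeta + b' s, see wave_axial *)
Let axial_modes a b b' := cubic_modes (a * (nu ^+ 3 - 3 / 2 * nu * sg ^+ 2))
  (a * (3 / 2 * nu * sg ^+ 2) + b * nu + b')
  (a * (3 * nu ^+ 2 * sg - 3 / 4 * sg ^+ 3)) (a * (3 / 4 * sg ^+ 3) + b * sg)
  (a * (3 / 2 * nu * sg ^+ 2)) (a / 4 * sg ^+ 3).

Lemma wave_axial a b b' phi s : -1 <= s <= 1 ->
  wave 4 (axial_modes a b b') phi s =
  a * zeta phi s ^+ 3 + b * zeta phi s + b' * s.
Proof.
move=> s1; rewrite wave_cubic zetaE.
have c2 : cos (2 * phi) = 2 * cos phi ^+ 2 - 1.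
  by rewrite mulr_natl cos_mulr2n -mulr_natl.
have c3 : cos (3 * phi) = 4 * cos phi ^+ 3 - 3 * cos phi.
  have -> : 3 * phi = 2 * phi + phi by ring.
  rewrite cosD c2 [in sin (2 * _)]mulr_natl sin_mulr2n -mulr_natl.
  transitivity (2 * cos phi ^+ 3 - cos phi - 2 * cos phi * sin phi ^+ 2); first ring.
  by rewrite sin2cos2; ring.
rewrite c2 c3.
have r3 : colat s ^+ 3 = colat s * (1 - s ^+ 2) by rewrite exprS sqr_colat.
have -> : sg * (colat s * cos phi) + nu * s = sg * cos phi * colat s + nu * s by ring.
have -> : (sg * cos phi * colat s + nu * s) ^+ 3 =
   (sg * cos phi) ^+ 3 * colat s ^+ 3 + 3 * (sg * cos phi) ^+ 2 * nu * s * colat s ^+ 2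
   + 3 * (sg * cos phi) * nu ^+ 2 * s ^+ 2 * colat s + nu ^+ 3 * s ^+ 3 by ring.
by rewrite r3 sqr_colat //; field.
Qed.

Lemma laplacian_axial omega : wave_laplacian (axial_modes 5 (- (3 + omega)) omega) =
  axial_modes (-60) (36 + 2 * omega) (- 2 * omega).
Proof.
rewrite laplacian_cubic; congr cubic_modes; try by field.
  have n3 : nu ^+ 3 = nu * (1 - sg ^+ 2) by rewrite -sgnu; ring.
  by rewrite n3; field.
have n2 : nu ^+ 2 = (1 - sg ^+ 2) by rewrite -sgnu; ring.
by rewrite n2; field.
Qed.

(** The 3-jet in the inertial frame, tilted, and seen again from the rotating
    frame. *)
Definition tilted_jet omega x : R :=
  5 * axial x ^+ 3 - (3 + omega) * axial x + omega * height x.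

Lemma coord_tilted omega phi s : -1 <= s <= 1 ->
  Defs.coord (tilted_jet omega) phi s =
  wave 4 (axial_modes 5 (- (3 + omega)) omega) phi s.
Proof.
move=> s1; rewrite wave_axial // /Defs.coord /tilted_jet axial_sph /height.
by have [_ _ ->] := sphE phi s; ring.
Qed.

(** The chain rule: up to the term b' s, the derivatives are those of zeta times the
    same factor in both coordinates. *)
Lemma wave_axial_partials a b b' phi s : -1 < s < 1 ->
  let p := axial_modes a b b' in
  let z := zeta phi s in
  let q := cubic_modes 0 nu 0 sg 0 0 in
  wave_s 4 p phi s = (3 * a * z ^+ 2 + b) * wave_s 4 q phi s + b' /\
  wave_phi 4 p phi s = (3 * a * z ^+ 2 + b) * wave_phi 4 q phi s.
Proof.
move=> s1 p z q; split.
  apply: der_unique (der_wave_s 4 p phi s1) _.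
  have dz := der_wave_s 4 q phi s1.
  have d := derD (derD (derM (derC a s 1) (derX 3 dz)) (derM (derC b s 1) dz))
    (derM (derC b' s 1) (is_derive_id s (1 : R))).
  apply: near_eq_is_derive.
    have : s \in `]-1, 1[%R by rewrite in_itv.
    move=> /near_in_itvoo; apply: filterS => y; rewrite in_itv /= => y1.
    by rewrite wave_axial //; lra.
  by apply: (is_derive_eq d); rewrite /z /zeta /q /=; ring.
apply: der_unique.
  by have := der_wave_phi 4 p 0 phi s; rewrite subr0; exact.
have := der_wave_phi 4 q 0 phi s; rewrite subr0 => dz.
have d := derD (derD (derM (derC a phi 1) (derX 3 dz)) (derM (derC b phi 1) dz))
    (derC (b' * s) phi 1).
have -> : (fun phi => wave 4 p (phi - 0) s) =
    (fun phi => a * wave 4 q (phi - 0) s ^+ 3 + b * wave 4 q (phi - 0) s + b' * s).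
  by apply/funext => u; rewrite wave_axial //; lra.
by apply: (is_derive_eq d); rewrite subr0 /z /zeta /q /=; ring.
Qed.

(** With c = -omega, the stream function in the moving frame and the absolute
    vorticity are both functions of zeta, so their Jacobian vanishes. *)
Lemma tilted_travelling omega : travelling_wave omega (tilted_jet omega) (- omega).
Proof.
apply: cubic_travelling.
  exact: coord_tilted.
move=> phi s s1 p; rewrite /p laplacian_axial.
have [-> ->] := wave_axial_partials 5 (- (3 + omega)) omega phi s1.
by have [-> ->] := wave_axial_partials (-60) (36 + 2 * omega) (- 2 * omega) phi s1; ring.
Qed.

End Tilt.

Section TiltTopology.
Variables (R : realType) (sg nu : R).
Hypothesis sgnu : sg ^+ 2 + nu ^+ 2 = 1.
Local Notation E := 'rV[R]_3.
Local Notation axial := (axial sg nu).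
Implicit Types (x y p q v : E) (z t : R).

Definition axis : E := vec3 sg 0 nu.

Lemma axial_axis : axial axis = 1.
Proof. by rewrite /axial; have [-> _ ->] := vec3E sg 0 nu; rewrite -sgnu; ring. Qed.

Lemma axialN x : axial (- x) = - axial x.
Proof. by rewrite /axial !mxE; ring. Qed.

Lemma sphere_axis : sphere axis.
Proof.
by apply/sphereP; have [-> -> ->] := vec3E sg 0 nu; rewrite -sgnu; ring.
Qed.

Lemma sphereN x : sphere x -> sphere (- x).
Proof. by move=> /sphereP x1; apply/sphereP; rewrite !mxE !sqrrN. Qed.

(** The squared norm in the orthonormal frame made of the axis, (nu, 0, -sg) and
    the y axis. *)
Lemma axial_pythagoras x : sphere x ->
  axial x ^+ 2 + (nu * x 0 0 - sg * x 0 ord_max) ^+ 2 + x 0 1 ^+ 2 = 1.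
Proof.
move=> /sphereP; rewrite -[X in X + _ + _]mul1r -[X in _ + X]mul1r -sgnu => <-.
by rewrite /axial; ring.
Qed.

Lemma axial_bound x : sphere x -> -1 <= axial x <= 1.
Proof.
move=> /axial_pythagoras H.
have : axial x ^+ 2 <= 1.
  by have := sqr_ge0 (nu * x 0 0 - sg * x 0 ord_max); have := sqr_ge0 (x 0 1); lra.
by move: (axial x) => a a1; apply/andP; split; nra.
Qed.

Lemma axial_eq1 x : sphere x -> axial x = 1 -> x = axis.
Proof.
move=> /axial_pythagoras H x1; move: H; rewrite x1 expr1n => H.
have y0 : x 0 1 = 0.
  apply/eqP; rewrite -sqrf_eq0; apply/eqP.
  have := sqr_ge0 (nu * x 0 0 - sg * x 0 ord_max); have := sqr_ge0 (x 0 1); lra.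
have w0 : nu * x 0 0 - sg * x 0 ord_max = 0.
  apply/eqP; rewrite -sqrf_eq0; apply/eqP.
  have := sqr_ge0 (nu * x 0 0 - sg * x 0 ord_max); have := sqr_ge0 (x 0 1); lra.
have [a0 a1 a2] := vec3E sg 0 nu.
apply: eq_vec3; rewrite ?a0 ?a1 ?a2 //.
  rewrite -[LHS]mul1r -sgnu; transitivity (sg * axial x + nu * (nu * x 0 0 - sg * x 0 ord_max)).
    by rewrite /axial; ring.
  by rewrite x1 w0; ring.
rewrite -[LHS]mul1r -sgnu; transitivity (nu * axial x - sg * (nu * x 0 0 - sg * x 0 ord_max)).
  by rewrite /axial; ring.
by rewrite x1 w0; ring.
Qed.

Lemma axial_lt1 x : sphere x -> x <> axis -> x <> - axis -> -1 < axial x < 1.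
Proof.
move=> sx xn xs; have /andP[l u] := axial_bound sx.
rewrite !lt_neqAle l u !andbT; apply/andP; split; apply/eqP => H.
  by apply: xs; rewrite -[x]opprK (axial_eq1 (sphereN sx)) // axialN -H opprK.
by apply: xn; exact: axial_eq1.
Qed.

Lemma continuous_axial : continuous axial.
Proof.
move=> x; have c i : {for x, continuous (fun x : E => x 0 i)} := @continuous_coord R i x.
exact: ctD (ctM (ctC sg x) (c 0)) (ctM (ctC nu x) (c ord_max)).
Qed.

(** The circle of latitude z with respect to the axis. *)
Definition parallel z t : E :=
  vec3 (z * sg + colat z * nu * cos t) (colat z * sin t) (z * nu - colat z * sg * cos t).

Lemma parallel_loop z : -1 < z < 1 ->
  simple_loop (fun a => parallel z (2 * pi * a)) [set y | sphere y /\ axial y = z].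
Proof.
move=> z1; have r0 := colat_gt0 z1.
have r2 : colat z ^+ 2 = 1 - z ^+ 2 by apply: sqr_colat; lra.
have axp t : axial (parallel z t) = z.
  rewrite /axial; have [-> _ ->] := vec3E (z * sg + colat z * nu * cos t)
    (colat z * sin t) (z * nu - colat z * sg * cos t).
  by rewrite -[RHS]mulr1 -sgnu; ring.
apply: simple_loop_angle.
- move=> t.
  have cc : {for t, continuous (@cos R)} := @continuous_cos R t.
  have cs : {for t, continuous (@sin R)} := @continuous_sin R t.
  exact: (ct_vec3 (ctD (ctC (z * sg) t) (ctM (ctC (colat z * nu) t) cc))
    (ctM (ctC (colat z) t) cs) (ctB (ctC (z * nu) t) (ctM (ctC (colat z * sg) t) cc))).
- by move=> t; rewrite /parallel mulr_natl cosD2pi sinD2pi.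
- move=> t u tu.
  have e1 : parallel z t 0 1 = parallel z u 0 1 by rewrite tu.
  have e0 : nu * parallel z t 0 0 - sg * parallel z t 0 ord_max =
      nu * parallel z u 0 0 - sg * parallel z u 0 ord_max by rewrite tu.
  have pE w : parallel z w 0 1 = colat z * sin w /\
      nu * parallel z w 0 0 - sg * parallel z w 0 ord_max = colat z * cos w.
    have [-> -> ->] := vec3E (z * sg + colat z * nu * cos w)
      (colat z * sin w) (z * nu - colat z * sg * cos w).
    by split=> //; rewrite -[RHS]mulr1 -sgnu; ring.
  move: e1 e0; rewrite !(pE t).1 !(pE t).2 !(pE u).1 !(pE u).2.
  by split; apply: (mulfI (lt0r_neq0 r0)).
- move=> y; split=> [[sy yz]|[t _ <-]].
    have [t [t0 ct st]] : exists t : R, [/\ 0 <= t < 2 * pi,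
        cos t = (nu * y 0 0 - sg * y 0 ord_max) / colat z & sin t = y 0 1 / colat z].
      apply: angle_exists; rewrite !expr_div_n -mulrDl r2.
      have := axial_pythagoras sy; rewrite yz => H.
      apply: (@mulIf _ (1 - z ^+ 2)); first by rewrite -r2 expf_neq0 // gt_eqF.
      by rewrite divfK ?mul1r -?r2 ?expf_neq0 ?gt_eqF // r2; lra.
    exists t => //; rewrite /parallel ct st.
    have nr : colat z != 0 by rewrite gt_eqF.
    have [a0 a1 a2] := vec3E (z * sg + colat z * nu * ((nu * y 0 0 - sg * y 0 ord_max) / colat z))
      (colat z * (y 0 1 / colat z)) (z * nu - colat z * sg * ((nu * y 0 0 - sg * y 0 ord_max) / colat z)).
    apply: eq_vec3; rewrite ?a0 ?a1 ?a2; move: (colat z) nr => rho nr; rewrite -?yz /axial.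
    + by rewrite -[RHS]mul1r -sgnu; field.
    + by field.
    + by rewrite -[RHS]mul1r -sgnu; field.
  split=> //; apply/sphereP.
  have [-> -> ->] := vec3E (z * sg + colat z * nu * cos t)
      (colat z * sin t) (z * nu - colat z * sg * cos t).
  transitivity ((sg ^+ 2 + nu ^+ 2) * (z ^+ 2 + colat z ^+ 2 * cos t ^+ 2) + colat z ^+ 2 * sin t ^+ 2).
    by ring.
  by rewrite sgnu r2 sin2cos2; ring.
Qed.

Variable kappa : R.
Hypothesis kappaP : kappa < 0 \/ 15 < kappa.

Definition axial_cubic x : R := 5 * axial x ^+ 3 - kappa * axial x.

Let h := axial_cubic.

(** Where 5 z^3 - kappa z is strictly monotone: its difference quotient is
    5 (z^2 + z w + w^2) - kappa and the quadratic form ranges over [0, 3]. *)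
Lemma cubic_inj z w : -1 <= z <= 1 -> -1 <= w <= 1 ->
  5 * z ^+ 3 - kappa * z = 5 * w ^+ 3 - kappa * w -> z = w.
Proof.
move=> z1 w1 H.
have : (z - w) * (5 * (z ^+ 2 + z * w + w ^+ 2) - kappa) = 0.
  by transitivity (5 * z ^+ 3 - kappa * z - (5 * w ^+ 3 - kappa * w)); [ring|rewrite H subrr].
move/eqP; rewrite mulf_eq0 subr_eq0 => /orP[/eqP//|/eqP E0].
by case: kappaP => k0; exfalso; nra.
Qed.

Lemma der_axial_cubic p v : sphere p -> is_derive p v (hext h)
  ((15 * axial p ^+ 2 - kappa) * (axial v - dotv p v * axial p)).
Proof.
move=> p1.
have e1 : enorm p = 1 := p1.
have d0 := der_hext_coord 0 v p1; have d2 := der_hext_coord ord_max v p1.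
have da := derD (derM (derC sg p v) d0) (derM (derC nu p v) d2).
have := derB (derM (derC 5 p v) (derX 3 da)) (derM (derC kappa p v) da).
move=> d; apply: (is_derive_eq d).
by rewrite e1 invr1 scale1r /axial /=; ring.
Qed.

(** The derivative in the direction of the axis has the factor
    1 - (axial p)^2. *)
Lemma stagnation_axial p : stagnation h p -> p = axis \/ p = - axis.
Proof.
move=> [p1 st].
have := st axis; have [_ ->] := der_axial_cubic axis p1 => /eqP.
have dp : dotv p axis = axial p.
  by rewrite dotvE; have [-> -> ->] := vec3E sg 0 nu; rewrite /axial; ring.
rewrite mulf_eq0 axial_axis dp => /orP[/eqP H|/eqP H].
  by have := axial_bound p1; case: kappaP => k0 b; exfalso; nra.
have : (1 - axial p) * (1 + axial p) = 0 by rewrite -[RHS]H; ring.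
move/eqP; rewrite mulf_eq0 subr_eq0 addr_eq0 => /orP[/eqP e|/eqP e].
  by left; exact: axial_eq1.
right; rewrite -[p]opprK; congr (- _); apply: axial_eq1; first exact: sphereN.
by rewrite axialN -e.
Qed.

Lemma stagnation_axis p : sphere p -> axial p ^+ 2 = 1 ->
  p = axis \/ p = - axis -> stagnation h p.
Proof.
move=> p1 pp pa; split=> // v; have [_ ->] := der_axial_cubic v p1.
have -> : axial v = axial p * dotv p v.
  have dp : dotv axis v = axial v.
    by rewrite dotvE; have [-> -> ->] := vec3E sg 0 nu; rewrite /axial; ring.
  case: pa => ->; rewrite ?axialN axial_axis.
    by rewrite dp mul1r.
  by rewrite mulN1r dotvE !mxE -dp dotvE !mxE /=; ring.
by rewrite [dotv _ _ * _]mulrC subrr mulr0.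
Qed.

Lemma streamline_axial x : sphere x -> x <> axis -> x <> - axis ->
  streamline h x = [set y | sphere y /\ axial y = axial x].
Proof.
move=> sx xn xs; have x1 := axial_lt1 sx xn xs.
rewrite /streamline.
have -> : @sphere R `&` [set y | h y = h x] = [set y | sphere y /\ axial y = axial x].
  apply/seteqP; split=> y [sy]; last by move=> yx; split=> //; rewrite /h /axial_cubic /= yx.
  by move=> /cubic_inj yx; split=> //; apply: yx; exact: axial_bound.
apply: connected_component_id => //.
exact: simple_loop_connected (parallel_loop x1).
Qed.

Lemma closed_streamline_axial x : sphere x -> x <> axis -> x <> - axis ->
  closed_streamline h x.
Proof.
move=> sx xn xs; have x1 := axial_lt1 sx xn xs.
split; first by rewrite streamline_axial //; eexists; exact: parallel_loop x1.
rewrite streamline_axial // => q [sq qx] /stagnation_axial[] qE; move: x1; rewrite -qx qE.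
  by rewrite axial_axis ltxx andbF.
by rewrite axialN axial_axis ltxx.
Qed.

Lemma unidirectional_axial : exists p q, [/\ p <> q, Defs.center h p, Defs.center h q,
    forall x, stagnation h x -> x = p \/ x = q
  & forall x, sphere x -> x <> p -> x <> q ->
      simple_closed_curve (streamline h x) /\ separates (streamline h x) p q].
Proof.
have na : axis <> - axis.
  move=> /(congr1 axial); rewrite axialN axial_axis; lra.
exists axis, (- axis); split=> //.
- split.
    by apply: stagnation_axis; [exact: sphere_axis|rewrite axial_axis expr1n|left].
  have /= : \forall q \near axis, 0 < axial q.
    by apply: (cvgr_gt _ (@continuous_axial axis)); rewrite axial_axis.
  apply: filterS => q q0 sq qn; apply: closed_streamline_axial => // qs.
  by move: q0; rewrite qs axialN axial_axis; lra.
- split.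
    apply: stagnation_axis; last by right.
      exact/sphereN/sphere_axis.
    by rewrite axialN axial_axis sqrrN expr1n.
  have /= : \forall q \near - axis, axial q < 0.
    by apply: (cvgr_lt _ (@continuous_axial (- axis))); rewrite axialN axial_axis oppr_lt0.
  apply: filterS => q q0 sq qs; apply: closed_streamline_axial => // qn.
  by move: q0; rewrite qn axial_axis; lra.
- exact: stagnation_axial.
- move=> x sx xn xs; have [sc _] := closed_streamline_axial sx xn xs; split=> //.
  have x1 := axial_lt1 sx xn xs.
  rewrite streamline_axial //; split.
  + by move=> [_]; rewrite axial_axis => H; move: x1; rewrite -H ltxx andbF.
  + by move=> [_]; rewrite axialN axial_axis => H; move: x1; rewrite -H ltxx.
  + set K := connected_component _ _ => Kq.
    have Kn : K axis.
      apply: connected_component_refl; split; first exact: sphere_axis.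
      by move=> [_]; rewrite axial_axis => H; move: x1; rewrite -H ltxx andbF.
    have [|y Ky yx] := @connected_IVT _ _ K axial (- axis) axis (axial x)
      (@component_connected _ _ _) continuous_axial Kq Kn.
      by rewrite axialN axial_axis; lra.
    have [sy ny] := connected_component_sub Ky.
    by apply: ny.
Qed.

End TiltTopology.

Section TiltedJet.
Variable R : realType.
Local Notation E := 'rV[R]_3.

(** As the axis tends to the polar one, all coefficients of the difference with the
    3-jet tend to zero. *)
Lemma tilted_jet_unidirectional (omega eps : R) (w : nat -> R) :
  omega < -3 \/ 12 < omega -> 0 < eps ->
  exists (Psi : E -> R) (c : R),
    [/\ unidirectional_travelling_wave omega Psi c,
        ~ zonal Psi
      & (sqrte (\sum_(0 <= l <oo)
          (w l * sph_energy (Psi \- three_jet)%R l)%:E) < eps%:E)%E].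
Proof.
move=> om eps0.
have [eta eta0 small] := weighted_norm_small w eps0.
pose coefs (s n : R) : seq R := [:: 5 * (n ^+ 3 - 3 / 2 * n * s ^+ 2) - 5;
  5 * (3 / 2 * n * s ^+ 2) + - (3 + omega) * n + omega + 3;
  5 * (3 * n ^+ 2 * s - 3 / 4 * s ^+ 3);
  5 * (3 / 4 * s ^+ 3) + - (3 + omega) * s;
  5 * (3 / 2 * n * s ^+ 2);
  5 / 4 * s ^+ 3].
have [s [n [s0 sn smallc]]] : exists s n : R,
   [/\ s != 0, s ^+ 2 + n ^+ 2 = 1 & all (fun c => `|c| <= eta) (coefs s n)].
  have near0 (f : R -> R) : {for 0, continuous f} -> f 0 = 0 ->
      \forall s \near (0 : R)^'+, `|f s| <= eta.
    move=> fc f0; have /cvgr_dist_le/(_ _ eta0) := cvg_at_right_filter fc.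
    by apply: filterS => s; rewrite f0 sub0r normrN.
  have colat0 : colat (0 : R) = 1 by rewrite /colat expr0n subr0 sqrtr1.
  have cs : {for (0 : R), continuous (fun s : R => s)} by exact: cvg_id.
  have cn : {for (0 : R), continuous (@colat R)}.
    exact: (ct_comp (@sqrt_continuous R) (ctB (ctC 1 0) (ctX 2 cs))).
  have n1 := near0 _ (ctB (ctM (ctC 5 _) (ctB (ctX 3 cn)
    (ctM (ctM (ctC (3 / 2) _) cn) (ctX 2 cs)))) (ctC 5 _)).
  have n2 := near0 _ (ctD (ctD (ctD (ctM (ctC 5 _) (ctM (ctM (ctC (3 / 2) _) cn) (ctX 2 cs)))
    (ctM (ctC (- (3 + omega)) _) cn)) (ctC omega _)) (ctC 3 _)).
  have n3 := near0 _ (ctM (ctC 5 _) (ctB (ctM (ctM (ctC 3 _) (ctX 2 cn)) cs)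
     (ctM (ctC (3 / 4) _) (ctX 3 cs)))).
  have n4 := near0 _ (ctD (ctM (ctC 5 _) (ctM (ctC (3 / 4) _) (ctX 3 cs)))
     (ctM (ctC (- (3 + omega)) _) cs)).
  have n5 := near0 _ (ctM (ctC 5 _) (ctM (ctM (ctC (3 / 2) _) cn) (ctX 2 cs))).
  have n6 := near0 _ (ctM (ctC (5 / 4) _) (ctX 3 cs)).
  near (0 : R)^'+ => s.
  exists s, (colat s).
  have s0 : 0 < s by near: s; exact: nbhs_right_gt.
  have s1 : s < 1 by near: s; exact: nbhs_right_lt.
  split; first by rewrite gt_eqF.
    by rewrite sqr_colat; [ring|lra].
  rewrite /coefs /= andbT; apply/and5P; split; last (apply/andP; split); near: s.
  - by apply: n1; rewrite colat0; ring.
  - by apply: n2; rewrite colat0; ring.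
  - by apply: n3; rewrite colat0; ring.
  - by apply: n4; ring.
  - by apply: n5; rewrite colat0; ring.
  - by apply: n6; ring.
exists (tilted_jet s n omega), (- omega).
have hE : moving_frame (tilted_jet s n omega) (- omega) = axial_cubic s n (3 + omega).
  by apply/funext => x; rewrite /moving_frame /tilted_jet /axial_cubic; ring.
split.
- split; first exact: tilted_travelling.
  by rewrite hE /=; apply: unidirectional_axial => //; case: om => ?; [left|right]; lra.
- move=> /(_ 0 pi 0); rewrite lerN10 ler01 => /(_ isT).
  rewrite /Defs.coord /tilted_jet /axial /height.
  have [-> _ ->] := sphE (0 : R) 0; have [-> _ ->] := sphE (pi : R) 0.
  rewrite /colat expr0n subr0 sqrtr1 cos0 cospi => H.
  have : s * (5 * s ^+ 2 - (3 + omega)) = 0 by move: H; lra.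
  move/eqP; rewrite mulf_eq0 (negPf s0) /= => /eqP k0.
  have s1 : 0 <= s ^+ 2 <= 1 by rewrite sqr_ge0 -sn lerDl sqr_ge0.
  by case: om => ?; lra.
- apply: small; move: smallc; rewrite /coefs /= => /and5P[ca cb cc cd /and3P[ce cg _]].
  apply: (wave_coefs_le_cubic (ltW eta0) _ ca cb cc cd ce cg) => phi z z1.
  transitivity (Defs.coord (tilted_jet s n omega) phi z - Defs.coord three_jet phi z) => //.
  rewrite coord_tilted // !wave_cubic /Defs.coord /three_jet /height.
  by have [_ _ ->] := sphE phi z; ring.
Unshelve. all: by end_near. Qed.
End TiltedJet.

(** * A travelling wave of degree three with saddles *)

Section SecondDerivative.
Variable R : realType.
Local Notation E := 'rV[R]_3.

Lemma derive_twice (f : E -> R) p v :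
  'D_v ('D_v f) p = (derive1 (derive1 (fun t => f (p + t *: v))) 0).
Proof.
rewrite -[in LHS](addr0 p) -[X in 'D_v _ (p + X)](scale0r v) derive_line.
by congr (derive1 _ 0); apply/funext => t; rewrite derive_line.
Qed.

(** Along the normalized line (p + t v) / |p + t v|, with p and v orthonormal, the
    cubic and linear parts of the stream function are divided by different powers
    of |p + t v| = (1 + t^2)^(1/2). *)
Lemma second_derivative (C L : {poly R}) (k : R) :
  derive1 (derive1 (fun t => (Num.sqrt (1 + t ^+ 2))^-1 ^+ 3 * C.[t]
             - k * ((Num.sqrt (1 + t ^+ 2))^-1 * L.[t]))) 0 =
  (deriv (deriv C)).[0] - 3 * C.[0] - k * ((deriv (deriv L)).[0] - L.[0]).
Proof.
pose n (t : R) := (Num.sqrt (1 + t ^+ 2))^-1.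
have q0 (t : R) : 0 < 1 + t ^+ 2 by have := sqr_ge0 t; lra.
have dn (t : R) : is_derive t (1 : R) n (- t * n t ^+ 3).
  have d2 := derD (derC 1 t (1 : R)) (derX 2 (is_derive_id t (1 : R))).
  have s0 : 0 < Num.sqrt (1 + t ^+ 2) by rewrite sqrtr_gt0.
  have d3 := der_comp (f := fun t : R => 1 + t ^+ 2) (is_derive1_sqrt (q0 t)) d2.
  apply: (is_derive_eq (derV _ d3)).
    by rewrite gt_eqF.
  by rewrite /n /=; field; rewrite gt_eqF.
have d1 (t : R) : is_derive t (1 : R) (fun t => n t ^+ 3 * C.[t] - k * (n t * L.[t]))
    (n t ^+ 3 * (deriv C).[t] - 3 * t * n t ^+ 5 * C.[t]
     - k * (n t * (deriv L).[t] - t * n t ^+ 3 * L.[t])).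
  have dC := derM (derX 3 (dn t)) (is_derive_poly C t).
  have dL := derM (derC k t (1 : R)) (derM (dn t) (is_derive_poly L t)).
  by apply: (is_derive_eq (derB dC dL)); rewrite /=; ring.
have -> : derive1 (fun t => (Num.sqrt (1 + t ^+ 2))^-1 ^+ 3 * C.[t]
             - k * ((Num.sqrt (1 + t ^+ 2))^-1 * L.[t])) =
    (fun t => n t ^+ 3 * (deriv C).[t] - 3 * t * n t ^+ 5 * C.[t]
     - k * (n t * (deriv L).[t] - t * n t ^+ 3 * L.[t])).
  by apply/funext => t; rewrite derive1E; have [_ ->] := d1 t.
have dn0 := dn 0; have id0 := is_derive_id (0 : R) (1 : R).
have dC := derM (derX 3 dn0) (is_derive_poly (deriv C) 0).
have dC2 := derM (derM (derM (derC 3 (0 : R) (1 : R)) id0) (derX 5 dn0)) (is_derive_poly C 0).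
have dL := derM dn0 (is_derive_poly (deriv L) 0).
have dL2 := derM (derM id0 (derX 3 dn0)) (is_derive_poly L 0).
have d := derB (derB dC dC2) (derM (derC k (0 : R) (1 : R)) (derB dL dL2)).
rewrite derive1E; have [_ ->] := d.
have -> : n 0 = 1 by rewrite /n expr0n addr0 sqrtr1 invr1.
rewrite /=; ring.
Qed.

End SecondDerivative.

Section Eye.
Variables (R : realType) (k e : R).
Hypothesis small : [/\ 0 < e, e < k & k + 2 * e < 15].
Local Notation E := 'rV[R]_3.
Implicit Types (x y p q v w : E) (z d t : R).

Let X x : R := x 0 0.
Let Y x : R := x 0 1.
Let Z x : R := x 0 ord_max.

(** The stream function in the moving frame; the conditions on k and e keep the
    centers and the saddles strictly between the equator and the pole. *)
Definition eye_stream x : R := 5 * Z x ^+ 3 - k * Z x - e * Z x * (X x ^+ 2 - Y x ^+ 2).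

Let h := eye_stream.

Definition center_height : R := Num.sqrt ((k + e) / (3 * (5 + e))).
Definition saddle_height : R := Num.sqrt ((k - e) / (3 * (5 - e))).
Let zc := center_height.
Let zs := saddle_height.

Lemma center_heightP : 0 < zc /\ (k + e) = 3 * (5 + e) * zc ^+ 2.
Proof.
have [e0 ek ke] := small.
have q : 0 < (k + e) / (3 * (5 + e)) by rewrite divr_gt0 // ?mulr_gt0 //; lra.
split; first by rewrite sqrtr_gt0.
by rewrite sqr_sqrtr ?(ltW q) //; field; rewrite gt_eqF //; lra.
Qed.

Lemma saddle_heightP : [/\ 0 < zs, zs < 1 & (k - e) = 3 * (5 - e) * zs ^+ 2].
Proof.
have [e0 ek ke] := small.
have q : 0 < (k - e) / (3 * (5 - e)) by rewrite divr_gt0 // ?mulr_gt0 //; lra.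
have z0 : 0 < zs by rewrite sqrtr_gt0.
have zE : (k - e) = 3 * (5 - e) * zs ^+ 2.
  by rewrite sqr_sqrtr ?(ltW q) //; field; rewrite gt_eqF //; lra.
split=> //; rewrite ltNge; apply/negP => z1.
have z2 : 1 <= zs ^+ 2 by nra.
have : 0 <= (5 - e) * (zs ^+ 2 - 1) by rewrite mulr_ge0; lra.
by lra.
Qed.

Lemma der_eye p v : sphere p -> is_derive p v (hext h)
  (let X' := v 0 0 - dotv p v * X p in let Y' := v 0 1 - dotv p v * Y p in
   let Z' := v 0 ord_max - dotv p v * Z p in
   (15 * Z p ^+ 2 - k - e * (X p ^+ 2 - Y p ^+ 2)) * Z' - 2 * e * Z p * (X p * X' - Y p * Y')).
Proof.
move=> p1.
have e1 : enorm p = 1 := p1.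
have d0 := der_hext_coord 0 v p1; have d1 := der_hext_coord 1 v p1.
have d2 := der_hext_coord ord_max v p1.
have d := derB (derB (derM (derC 5 p v) (derX 3 d2)) (derM (derC k p v) d2))
  (derM (derM (derC e p v) d2) (derB (derX 2 d0) (derX 2 d1))).
apply: (is_derive_eq d).
by rewrite e1 invr1 scale1r /= /X /Y /Z; ring.
Qed.

Lemma sphereXYZ p : sphere p -> X p ^+ 2 + Y p ^+ 2 + Z p ^+ 2 = 1.
Proof. by move/sphereP. Qed.

Definition eye_center : E := vec3 (Num.sqrt (1 - zc ^+ 2)) 0 zc.

(** The tangent vectors (-y, x, 0) and (-z, 0, x) give the two equations. *)
Lemma stagnation_eye p : 0 < X p -> 0 < Z p -> stagnation h p -> Y p = 0 /\ Z p = zc.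
Proof.
have [e0 ek ke] := small.
move=> x0 z0 [sp st]; have p1 := sphereXYZ sp.
have [c0 cE] := center_heightP.
have vE a b c := vec3E a b c.
have y0 : Y p = 0.
  have := st (vec3 (- Y p) (X p) 0); have [_ ->] := der_eye (vec3 (- Y p) (X p) 0) sp.
  rewrite dotvE; have [-> -> ->] := vec3E (- Y p) (X p) 0.
  rewrite -/(X p) -/(Y p) -/(Z p) /= => H.
  have {H} : 4 * e * X p * Z p * Y p = 0 by rewrite -[RHS]H; ring.
  move/eqP; rewrite mulf_eq0 => /orP[|/eqP//].
  by rewrite gt_eqF // !mulr_gt0.
split=> //.
have := st (vec3 (- Z p) 0 (X p)); have [_ ->] := der_eye (vec3 (- Z p) 0 (X p)) sp.
rewrite dotvE; have [-> -> ->] := vec3E (- Z p) 0 (X p).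
rewrite -/(X p) -/(Y p) -/(Z p) /= => H.
have {H} : X p * (15 * Z p ^+ 2 - k - e * (X p ^+ 2 - Y p ^+ 2) + 2 * e * Z p ^+ 2) = 0.
  by rewrite -[RHS]H; ring.
move/eqP; rewrite mulf_eq0 gt_eqF //= => /eqP H.
have {H} H : 3 * (5 + e) * (Z p ^+ 2 - zc ^+ 2) = 0.
  rewrite mulrBr -cE; rewrite y0 in H p1.
  have {}p1 : X p ^+ 2 = 1 - Z p ^+ 2 by rewrite -p1; ring.
  by rewrite p1 in H; rewrite -[RHS]H; ring.
apply/eqP; rewrite -(eqrXn2 (n := 2)) ?(ltW z0) ?(ltW c0) // -subr_eq0.
by move/eqP: H; rewrite mulf_eq0 gt_eqF //; lra.
Qed.

Lemma center_stagnation p : sphere p -> Y p = 0 -> Z p = zc -> stagnation h p.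
Proof.
have [e0 ek ke] := small.
move=> sp y0 zE; split=> // v; have [_ ->] := der_eye v sp.
have [c0 cE] := center_heightP; have p1 := sphereXYZ sp.
rewrite /= y0 zE in p1 *.
have x2 : X p ^+ 2 = 1 - zc ^+ 2 by lra.
have s0 : X p * (v 0 0 - dotv p v * X p) = - (zc * (v 0 ord_max - dotv p v * zc)).
  have dv : dotv p v = X p * v 0 0 + zc * v 0 ord_max.
    by rewrite dotvE -/(X p) -/(Y p) -/(Z p) y0 zE mul0r addr0.
  transitivity (X p * v 0 0 - dotv p v * X p ^+ 2); first ring.
  by rewrite x2 [X in X - _](_ : _ = dotv p v - zc * v 0 ord_max) ?dv; ring.
rewrite s0 x2.
transitivity ((3 * (5 + e) * zc ^+ 2 - (k + e)) * (v 0 ord_max - dotv p v * zc)); first ring.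
by rewrite -cE subrr mul0r.
Qed.

(** The Hessian is positive along the meridian x = 0 and negative along x. *)
Lemma saddle_eye p : sphere p -> X p = 0 -> Z p = zs -> saddle h p.
Proof.
have [e0 ek ke] := small.
move=> sp xE zE; have [s0 s1 sE] := saddle_heightP; have p1 := sphereXYZ sp.
have p_eq : p = vec3 0 (Y p) zs.
  by have [a0 a1 a2] := vec3E 0 (Y p) zs; apply: eq_vec3; rewrite ?a0 ?a1 ?a2.
have y2 : Y p ^+ 2 = 1 - zs ^+ 2 by rewrite xE zE in p1; lra.
have unit_line v (t : R) : dotv v p = 0 -> dotv v v = 1 ->
    enorm (p + t *: v) = Num.sqrt (1 + t ^+ 2).
  move=> vp vv; congr Num.sqrt.
  have pp : dotv p p = 1 by rewrite dotvE -p1 /X /Y /Z; ring.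
  transitivity (dotv p p + 2 * t * dotv v p + t ^+ 2 * dotv v v).
    by rewrite !dotvE !mxE; ring.
  by rewrite pp vp vv; ring.
split.
- split=> // v; have [_ ->] := der_eye v sp.
  rewrite /= xE zE.
  have s2 : Y p * (v 0 1 - dotv p v * Y p) = - (zs * (v 0 ord_max - dotv p v * zs)).
    have dv : dotv p v = Y p * v 0 1 + zs * v 0 ord_max.
      by rewrite dotvE -/(X p) -/(Y p) -/(Z p) xE zE mul0r add0r.
    transitivity (Y p * v 0 1 - dotv p v * Y p ^+ 2); first ring.
    by rewrite y2 [X in X - _](_ : _ = dotv p v - zs * v 0 ord_max) ?dv; ring.
  rewrite mul0r s2 y2.
  transitivity ((3 * (5 - e) * zs ^+ 2 - (k - e)) * (v 0 ord_max - dotv p v * zs)); first ring.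
  by rewrite -sE subrr mul0r.
- have [w0 w1 w2] := vec3E 0 (- zs) (Y p); exists (vec3 0 (- zs) (Y p)).
  move: (vec3 0 _ _) w0 w1 w2 => w w0 w1 w2.
  have wp : dotv w p = 0 by rewrite dotvE w0 w1 w2 -/(Y p) -/(Z p) zE; ring.
  have ww : dotv w w = 1 by rewrite dotvE w0 w1 w2 -!expr2 y2; ring.
  split=> //; rewrite derive_twice.
  pose Zt : {poly R} := zs%:P + (Y p)%:P * 'X.
  pose Yt : {poly R} := (Y p)%:P - zs%:P * 'X.
  have -> : (fun t => hext h (p + t *: w)) =
     (fun t => (Num.sqrt (1 + t ^+ 2))^-1 ^+ 3 * (5%:P * (Zt * Zt * Zt) + e%:P * (Zt * (Yt * Yt))).[t]
             - k * ((Num.sqrt (1 + t ^+ 2))^-1 * Zt.[t])).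
    apply/funext => t; rewrite /hext unit_line // /h /eye_stream /X /Y /Z !mxE.
    rewrite -/(X p) -/(Y p) -/(Z p) w0 w1 w2 xE zE.
    by rewrite !(hornerD, hornerN, hornerM, horner_exp, hornerC, hornerX) /=; ring.
  rewrite second_derivative.
  have dZ : deriv Zt = (Y p)%:P.
    by rewrite /Zt !(derivD, derivM, derivC, derivX); ring.
  have dY : deriv Yt = - zs%:P.
    by rewrite /Yt !(derivB, derivM, derivC, derivX); ring.
  have hZ : Zt.[0] = zs by rewrite /Zt !hornerE; ring.
  have hY : Yt.[0] = Y p by rewrite /Yt !hornerE; ring.
  rewrite !(derivD, derivM, derivC, dZ, dY, derivN).
  rewrite !(hornerD, hornerN, hornerM, hornerC, horner0, hornerX).
  rewrite (_ : _ - _ = 2 * zs * (15 - 2 * e - k)); first by rewrite !mulr_gt0 //; lra.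
  transitivity (zs * (30 * Y p ^+ 2 + 2 * e * zs ^+ 2 - 4 * e * Y p ^+ 2 - 15 * zs ^+ 2
    - 3 * e * Y p ^+ 2 + k)); first ring.
  rewrite y2; have -> : k = e + 3 * (5 - e) * zs ^+ 2 by rewrite -sE; ring.
  ring.
- have [w0 w1 w2] := vec3E (1 : R) 0 0; exists (vec3 1 0 0).
  move: (vec3 1 _ _) w0 w1 w2 => w w0 w1 w2.
  have wp : dotv w p = 0 by rewrite dotvE w0 w1 w2 -/(X p) xE; ring.
  have ww : dotv w w = 1 by rewrite dotvE w0 w1 w2; ring.
  split=> //; rewrite derive_twice.
  pose C0 := 5 * zs ^+ 3 + e * zs * Y p ^+ 2.
  have -> : (fun t => hext h (p + t *: w)) =
     (fun t => (Num.sqrt (1 + t ^+ 2))^-1 ^+ 3 * (C0%:P - (e * zs)%:P * ('X * 'X)).[t]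
             - k * ((Num.sqrt (1 + t ^+ 2))^-1 * zs%:P.[t])).
    apply/funext => t; rewrite /hext unit_line // /h /eye_stream /X /Y /Z !mxE.
    rewrite -/(X p) -/(Y p) -/(Z p) w0 w1 w2 xE zE.
    by rewrite !(hornerD, hornerN, hornerM, horner_exp, hornerC, hornerX) /C0 /=; ring.
  rewrite second_derivative !(derivD, derivN, derivM, derivC, derivX).
  rewrite !(hornerD, hornerN, hornerM, hornerC, horner0, hornerX) /C0.
  rewrite (_ : _ - _ = - (4 * e * zs)); first by rewrite oppr_lt0 !mulr_gt0.
  transitivity (zs * (- 2 * e - 15 * zs ^+ 2 - 3 * e * Y p ^+ 2 + k)); first ring.
  rewrite y2; have -> : k = e + 3 * (5 - e) * zs ^+ 2 by rewrite -sE; ring.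
  ring.
Qed.

(** * The streamlines of a cat's eye *)

Definition saddle_level : R := - (2 * (5 - e) * zs ^+ 3).
Let es := saddle_level.

(** The cubic z ((5 + e) z^2 - (k + e)) takes the value of the level at y = 0 at
    two positive latitudes, [mid d] - d and [mid d] + d; as the cubic has no
    quadratic term its third root is -2 [mid d], whence the constraint
    3 ([mid d])^2 + d^2 = (k + e) / (5 + e). *)
Definition mid d : R := Num.sqrt (((k + e) / (5 + e) - d ^+ 2) / 3).
Definition eye_z d t : R := mid d - d * cos t.
Definition eye_stretch d t : R :=
  Num.sqrt ((5 + e) * (eye_z d t + 2 * mid d) / (2 * e * eye_z d t)).
Definition eye_y d t : R := d * sin t * eye_stretch d t.
Definition eye_point d t : E :=
  vec3 (Num.sqrt (1 - eye_y d t ^+ 2 - eye_z d t ^+ 2)) (eye_y d t) (eye_z d t).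
Definition eye_level d : R := 2 * (5 + e) * mid d * (mid d ^+ 2 - d ^+ 2).

Lemma saddle_level_lt0 : es < 0.
Proof.
have [e0 ek ke] := small; have [z0 _ _] := saddle_heightP.
by rewrite oppr_lt0 !mulr_gt0 ?exprn_gt0 //; lra.
Qed.

(** Elimination of x; the elimination of y instead, used on the meridian x = 0,
    exchanges e and -e. *)
Lemma eye_streamE p : sphere p ->
  h p = Z p * ((5 + e) * Z p ^+ 2 - (k + e) + 2 * e * Y p ^+ 2).
Proof.
move=> /sphereXYZ p1; rewrite /h /eye_stream -/(X p) -/(Y p) -/(Z p).
have -> : X p ^+ 2 = 1 - Y p ^+ 2 - Z p ^+ 2 by lra.
ring.
Qed.

(** The double root at the latitude of the saddles. *)
Lemma saddle_cubic z : (5 - e) * z ^+ 3 - (k - e) * z =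
  es + (5 - e) * ((z - zs) ^+ 2 * (z + 2 * zs)).
Proof. by have [_ _ ->] := saddle_heightP; rewrite /es /saddle_level; ring. Qed.

Lemma eye_stream_meridian p : sphere p -> 0 <= Z p -> X p = 0 ->
  es <= h p /\ (h p = es -> Z p = zs).
Proof.
move=> sp z0 x0; have [e0 ek ke] := small; have [s0 _ _] := saddle_heightP.
have hE : h p = es + (5 - e) * ((Z p - zs) ^+ 2 * (Z p + 2 * zs)).
  rewrite -saddle_cubic eye_streamE //.
  have -> : Y p ^+ 2 = 1 - Z p ^+ 2 by rewrite -(sphereXYZ sp) x0; ring.
  by ring.
rewrite hE; split.
  by rewrite lerDl; apply: mulr_ge0; [lra|apply: mulr_ge0; [exact: sqr_ge0|lra]].
move/eqP; rewrite -subr_eq0 addrAC subrr add0r !mulf_eq0.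
have e5 : 0 < 5 - e by lra.
have zz : 0 < Z p + 2 * zs by lra.
rewrite (gt_eqF e5) (gt_eqF zz).
by rewrite orbF /= orbb subr_eq0 => /eqP.
Qed.

(** Below the level of the saddles, the level curves in the plane of (y, z) stay in
    the unit disc, so that x can be recovered. *)
Lemma eye_stream_disc (y z : R) : 0 < z ->
  let g := z * ((5 + e) * z ^+ 2 - (k + e) + 2 * e * y ^+ 2) in
  (g <= es -> y ^+ 2 + z ^+ 2 <= 1) /\ (g < es -> y ^+ 2 + z ^+ 2 < 1).
Proof.
move=> z0 g; have [e0 ek ke] := small; have [s0 _ _] := saddle_heightP.
have gE : g = es + (5 - e) * ((z - zs) ^+ 2 * (z + 2 * zs))
    + 2 * e * z * (y ^+ 2 + z ^+ 2 - 1).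
  by rewrite -saddle_cubic /g; ring.
have s1 : 0 <= (5 - e) * ((z - zs) ^+ 2 * (z + 2 * zs)).
  by apply: mulr_ge0; [lra|apply: mulr_ge0; [exact: sqr_ge0|lra]].
have ez : 0 < 2 * e * z by rewrite !mulr_gt0.
split=> H.
  rewrite -subr_le0 -(pmulr_rle0 _ ez); lra.
rewrite -subr_lt0 -(pmulr_rlt0 _ ez); lra.
Qed.

Lemma midP d : 0 <= d -> 4 * d ^+ 2 < (k + e) / (5 + e) ->
  [/\ 0 < mid d, d < mid d & (5 + e) * (3 * mid d ^+ 2 + d ^+ 2) = k + e].
Proof.
move=> d0 d4; have [e0 ek ke] := small.
have q0 : 0 < ((k + e) / (5 + e) - d ^+ 2) / 3.
  have := sqr_ge0 d; have : 0 < (k + e) / (5 + e) by rewrite divr_gt0; lra.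
  lra.
have m0 : 0 < mid d by rewrite sqrtr_gt0.
have m2 : mid d ^+ 2 = ((k + e) / (5 + e) - d ^+ 2) / 3 by rewrite sqr_sqrtr // ltW.
split=> //; last by rewrite m2; field; rewrite gt_eqF; lra.
by rewrite -(ltr_pXn2r (n := 2)) ?nnegrE ?(ltW m0) // m2; lra.
Qed.

(** The condition on d is d < [mid d], so that the loop stays in the northern
    hemisphere; the one on the level is that the loop does not pass the saddles. *)
Definition admissible d :=
  [/\ 0 <= d, 4 * d ^+ 2 < (k + e) / (5 + e) & - eye_level d <= es].

Lemma eye_level_decr d d' : 0 <= d' -> d' < d -> 4 * d ^+ 2 < (k + e) / (5 + e) ->
  eye_level d < eye_level d'.
Proof.
move=> d0 dd d4; have [e0 ek ke] := small.
have dp : 0 < d by exact: le_lt_trans dd.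
have d2 : d' ^+ 2 < d ^+ 2 by rewrite ltrXn2r ?nnegrE // ltW.
have [m0 md mE] := midP (ltW dp) d4.
have d4' : 4 * d' ^+ 2 < (k + e) / (5 + e) by lra.
have [m0' md' mE'] := midP d0 d4'.
rewrite /eye_level.
have m2 : 3 * mid d ^+ 2 + d ^+ 2 = 3 * mid d' ^+ 2 + d' ^+ 2.
  by apply: (@mulfI _ (5 + e)); rewrite ?mE ?mE' // gt_eqF; lra.
have mm : mid d < mid d' by rewrite -(ltr_pXn2r (n := 2)) ?nnegrE ?ltW //; lra.
have md2 : d ^+ 2 < mid d ^+ 2 by rewrite ltrXn2r ?nnegrE // ltW.
rewrite -!mulrA ltr_pM2l // ltr_pM2l; last lra.
by apply: ltr_pM; rewrite ?ltW //; lra.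
Qed.

Lemma eye_z_gt0 d t : 0 <= d -> d < mid d -> 0 < eye_z d t.
Proof.
move=> d0 dm; rewrite /eye_z subr_gt0 (le_lt_trans _ dm) //.
by rewrite ler_piMr // cos_le1.
Qed.

Lemma eye_stretch_gt0 d t : 0 <= d -> d < mid d -> 0 < eye_stretch d t.
Proof.
move=> d0 dm; have [e0 ek ke] := small; have z0 := eye_z_gt0 t d0 dm.
by rewrite sqrtr_gt0 divr_gt0 // !mulr_gt0 //; lra.
Qed.

Lemma eye_pointE d t : [/\ X (eye_point d t) = Num.sqrt (1 - eye_y d t ^+ 2 - eye_z d t ^+ 2),
  Y (eye_point d t) = eye_y d t & Z (eye_point d t) = eye_z d t].
Proof. exact: vec3E. Qed.

Lemma sqr_eye_stretch d t : 0 <= d -> d < mid d ->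
  2 * e * eye_z d t * eye_stretch d t ^+ 2 = (5 + e) * (eye_z d t + 2 * mid d).
Proof.
move=> d0 dm; have [e0 ek ke] := small; have z0 := eye_z_gt0 t d0 dm.
rewrite sqr_sqrtr; first by field; rewrite !gt_eqF.
by rewrite divr_ge0 // !mulr_ge0 // ?ltW //; lra.
Qed.

Lemma eye_cubic d (z : R) : (5 + e) * (3 * mid d ^+ 2 + d ^+ 2) = k + e ->
  z * ((5 + e) * z ^+ 2 - (k + e)) =
  - eye_level d - (5 + e) * (z + 2 * mid d) * (d ^+ 2 - (z - mid d) ^+ 2).
Proof. by move=> <-; rewrite /eye_level; ring. Qed.

(** The loop lies on the level set by the factorization [eye_cubic]: along it
    d^2 - (z - mid d)^2 is d^2 times the square of the sine. *)
Lemma eye_pointP d t : admissible d -> let p := eye_point d t in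
  [/\ sphere p, 0 <= X p, 0 < Z p, h p = - eye_level d
    & - eye_level d < es -> 0 < X p].
Proof.
move=> [d0 d4 dl] p; have [m0 dm mE] := midP d0 d4.
have [xE yE zE] := eye_pointE d t.
have z0 := eye_z_gt0 t d0 dm.
have gE : eye_z d t * ((5 + e) * eye_z d t ^+ 2 - (k + e) + 2 * e * eye_y d t ^+ 2) = - eye_level d.
  transitivity (eye_z d t * ((5 + e) * eye_z d t ^+ 2 - (k + e))
     + d ^+ 2 * sin t ^+ 2 * (2 * e * eye_z d t * eye_stretch d t ^+ 2)).
    by rewrite /eye_y; ring.
  rewrite sqr_eye_stretch // (eye_cubic _ mE) sin2cos2 /eye_z; ring.
have [le lt] := eye_stream_disc (eye_y d t) z0; rewrite gE in le lt.
have sp : sphere p.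
  apply/sphereP; rewrite -/(X p) -/(Y p) -/(Z p) xE yE zE sqr_sqrtr; first ring.
  by have := le dl; lra.
split=> //; rewrite ?zE ?xE ?sqrtr_ge0 //; first by rewrite eye_streamE // yE zE gE.
by move=> /lt ?; rewrite sqrtr_gt0; lra.
Qed.

Lemma eye_point_inj d t u : 0 < d -> d < mid d -> eye_point d t = eye_point d u ->
  cos t = cos u /\ sin t = sin u.
Proof.
move=> d0 dm tu; have [_ yt zt] := eye_pointE d t; have [_ yu zu] := eye_pointE d u.
have zz : eye_z d t = eye_z d u by rewrite -zt -zu tu.
have ct : cos t = cos u.
  move: zz; rewrite /eye_z => /addrI/oppr_inj; apply: mulfI; by rewrite gt_eqF.
split=> //; have yy : eye_y d t = eye_y d u by rewrite -yt -yu tu.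
move: yy; rewrite /eye_y /eye_stretch zz => /mulIf.
rewrite gt_eqF; last exact: (eye_stretch_gt0 u (ltW d0) dm).
by move=> /(_ isT)/mulfI; apply; rewrite gt_eqF.
Qed.

(** The angle is read off from the coordinates: (mid d - z) / d and y / (d S), S
    the stretching factor, are the coordinates of a point of the unit circle. *)
Lemma eye_point_surj d q : admissible d -> 0 < d -> sphere q -> 0 <= X q -> 0 < Z q ->
  h q = - eye_level d -> exists2 t : R, 0 <= t < 2 * pi & eye_point d t = q.
Proof.
move=> [d0 d4 dl] dp sq x0 z0 hq; have [m0 dm mE] := midP d0 d4.
have [e0 ek ke] := small.
pose S := Num.sqrt ((5 + e) * (Z q + 2 * mid d) / (2 * e * Z q)).
have S2 : 2 * e * Z q * S ^+ 2 = (5 + e) * (Z q + 2 * mid d).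
  rewrite sqr_sqrtr; first by field; rewrite !gt_eqF.
  by rewrite divr_ge0 // !mulr_ge0 // ?ltW //; lra.
have S0 : 0 < S by rewrite sqrtr_gt0 divr_gt0 // !mulr_gt0 //; lra.
have y2 : Y q ^+ 2 = S ^+ 2 * (d ^+ 2 - (Z q - mid d) ^+ 2).
  have ez : 2 * e * Z q != 0 by rewrite gt_eqF // !mulr_gt0.
  apply: (mulfI ez); rewrite [RHS]mulrA S2.
  rewrite eye_streamE // in hq.
  have := eye_cubic (Z q) mE; lra.
have [t [t0 ct st]] : exists t : R, [/\ 0 <= t < 2 * pi,
    cos t = (mid d - Z q) / d & sin t = Y q / (d * S)].
  apply: angle_exists; rewrite !expr_div_n y2 exprMn; field.
  by rewrite !gt_eqF.
have zE : eye_z d t = Z q by rewrite /eye_z ct; field; rewrite gt_eqF.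
have yE : eye_y d t = Y q.
  by rewrite /eye_y /eye_stretch zE st -/S; field; rewrite !gt_eqF.
exists t => //; have [a0 a1 a2] := eye_pointE d t.
apply: eq_vec3; rewrite -?/(X _) -?/(Y _) -?/(Z _) ?a0 ?a1 ?a2 ?yE ?zE //.
have -> : 1 - Y q ^+ 2 - Z q ^+ 2 = X q ^+ 2 by rewrite -(sphereXYZ sq); ring.
by rewrite sqrtr_sqr ger0_norm.
Qed.

Let es0 : es < 0 := saddle_level_lt0.

Lemma continuous_mid : continuous mid.
Proof.
move=> d; have cd : {for d, continuous (fun d : R => d)} by exact: cvg_id.
exact: (ct_comp (@sqrt_continuous R)
  (ctM (ctB (ctC ((k + e) / (5 + e)) d) (ctX 2 cd)) (ctC 3^-1 d))).
Qed.

Lemma continuous_eye_level : continuous eye_level.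
Proof.
move=> d; have cd : {for d, continuous (fun d : R => d)} by exact: cvg_id.
have cm : {for d, continuous mid} := continuous_mid (x:=d).
exact: (ctM (ctM (ctC (2 * (5 + e)) d) cm) (ctB (ctX 2 cm) (ctX 2 cd))).
Qed.

Lemma ct_eye_point (T : topologicalType) (f g : T -> R) (x : T) :
  {for x, continuous f} -> {for x, continuous g} -> 0 < eye_z (f x) (g x) ->
  {for x, continuous (fun u => eye_point (f u) (g u))}.
Proof.
move=> cf cg z0; have [e0 ek ke] := small.
have cm : {for x, continuous (fun u => mid (f u))} := ct_comp continuous_mid cf.
have cz : {for x, continuous (fun u => eye_z (f u) (g u))}.
  exact: (ctB cm (ctM cf (ct_comp (@continuous_cos R) cg))).
have cst : {for x, continuous (fun u => eye_stretch (f u) (g u))}.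
  have c1 := ctM (ctC (5 + e) x) (ctD cz (ctM (ctC 2 x) cm)).
  have c2 := ctM (ctC (2 * e) x) cz.
  apply: (ct_comp (@sqrt_continuous R) (ctM c1 (ctV _ c2))).
  by rewrite gt_eqF // !mulr_gt0.
have cy : {for x, continuous (fun u => eye_y (f u) (g u))}.
  exact: (ctM (ctM cf (ct_comp (@continuous_sin R) cg)) cst).
exact: (ct_vec3 (ct_comp (@sqrt_continuous R)
  (ctB (ctB (ctC 1 x) (ctX 2 cy)) (ctX 2 cz))) cy cz).
Qed.

Lemma admissible_z d t : admissible d -> 0 < eye_z d t.
Proof. by move=> [d0 d4 _]; have [_ dm _] := midP d0 d4; exact: eye_z_gt0. Qed.

Lemma admissible_le d d' : 0 <= d' -> d' <= d -> admissible d ->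
  admissible d' /\ eye_level d <= eye_level d'.
Proof.
move=> d0 dd [_ d4 dl]; have [->|dn] := eqVneq d' d; first by split=> //; split=> //; rewrite (le_trans d0).
have lt : d' < d by rewrite lt_neqAle dn.
have le := eye_level_decr d0 lt d4.
split; last exact: ltW.
split=> //; last by apply: le_trans dl; rewrite lerN2 ltW.
apply: le_lt_trans d4; rewrite ler_pM2l //.
by rewrite lerXn2r ?nnegrE // (le_trans d0).
Qed.

Lemma eye_level_center : eye_level 0 = 2 * (5 + e) * zc ^+ 3.
Proof.
have [e0 ek ke] := small; have [z0 zE] := center_heightP.
have -> : eye_level 0 = 2 * (5 + e) * mid 0 ^+ 3.
  by rewrite /eye_level; ring.
congr (_ * _ ^+ 3); rewrite /mid /zc /center_height; congr Num.sqrt.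
by field; rewrite gt_eqF; lra.
Qed.

(** The intermediate value theorem between d = 0, the center, and the value of d
    for which the lower end of the loop reaches the equator, where h = 0. *)
Lemma eye_level_exists (v : R) : v <= es -> - eye_level 0 < v ->
  exists d, [/\ 0 < d, admissible d & v = - eye_level d].
Proof.
move=> ves v0; have [e0 ek ke] := small; have esN := es0.
pose D := Num.sqrt ((k + e) / (5 + e)) / 2.
have q0 : 0 < (k + e) / (5 + e) by rewrite divr_gt0; lra.
have D0 : 0 <= D by rewrite divr_ge0 ?sqrtr_ge0.
have D2 : 4 * D ^+ 2 = (k + e) / (5 + e).
  by rewrite /D expr_div_n sqr_sqrtr ?(ltW q0) //; field; rewrite gt_eqF; lra.
have mD : mid D ^+ 2 = D ^+ 2.
  rewrite /mid -D2 (_ : _ / 3 = D ^+ 2); last by field.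
  by rewrite sqrtr_sqr real_normK ?num_real.
have lD : eye_level D = 0 by rewrite /eye_level mD subrr mulr0.
have [|d] := @IVT R eye_level 0 D (- v) D0 (continuous_subspaceT continuous_eye_level).
  by rewrite lD ge_min le_max; apply/andP; split; apply/orP; [right|left]; lra.
rewrite in_itv /= => /andP[d0 dD] dv.
have dn0 : d != 0 by apply: contraTneq v0 => d00; rewrite -leNgt -d00 dv opprK.
have dnD : d != D by apply: contraTneq esN => dDE; rewrite -leNgt; move: dv; rewrite dDE lD; lra.
exists d; split; [by rewrite lt_def dn0| |by rewrite dv opprK].
split=> //; last by rewrite -[X in - X]/(eye_level d) dv opprK.
rewrite -D2 ltr_pM2l // ltrXn2r ?nnegrE //.
by rewrite lt_neqAle dnD.
Qed.

Let eye : set E := [set q | sphere q /\ [/\ 0 < X q, 0 < Z q & h q < es]].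

Let center := eye_center.

(** On a quarter of the sphere h is its minimum plus a sum of two nonnegative
    terms. *)
Lemma eye_stream_min q : sphere q -> 0 < Z q ->
  - eye_level 0 <= h q /\ (h q = - eye_level 0 -> Y q = 0 /\ Z q = zc).
Proof.
move=> sq z0; have [e0 ek ke] := small; have [c0 cE] := center_heightP.
have hE : h q = - eye_level 0 + ((5 + e) * ((Z q - zc) ^+ 2 * (Z q + 2 * zc))
     + 2 * e * Z q * Y q ^+ 2).
  by rewrite (eye_streamE sq) eye_level_center cE -/(Z q) -/(Y q); ring.
have s1 : 0 <= (5 + e) * ((Z q - zc) ^+ 2 * (Z q + 2 * zc)).
  by apply: mulr_ge0; [lra|apply: mulr_ge0; [exact: sqr_ge0|lra]].
have ez : 0 < 2 * e * Z q by rewrite !mulr_gt0.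
have s2 : 0 <= 2 * e * Z q * Y q ^+ 2 by rewrite mulr_ge0 ?sqr_ge0 // ltW.
rewrite hE; split; first lra.
move=> H.
have y0 : 2 * e * Z q * Y q ^+ 2 = 0 by lra.
have z1 : (5 + e) * ((Z q - zc) ^+ 2 * (Z q + 2 * zc)) = 0 by lra.
split; apply/eqP.
  by rewrite -sqrf_eq0; move/eqP: y0; rewrite mulf_eq0 (gt_eqF ez).
rewrite -subr_eq0 -sqrf_eq0; move/eqP: z1; rewrite mulf_eq0.
have e5 : 0 < 5 + e by lra.
have zz : 0 < Z q + 2 * zc by lra.
by rewrite (gt_eqF e5) /= mulf_eq0 (gt_eqF zz) orbF.
Qed.

(** At the saddles h exceeds its minimum on the quarter by at least the term in
    y^2. *)
Lemma saddle_above_center : - eye_level 0 < es.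
Proof.
have [e0 ek ke] := small; have [s0 s1 sE] := saddle_heightP; have [c0 cE] := center_heightP.
rewrite eye_level_center /es /saddle_level -/zs.
have y0 : 0 < 1 - zs ^+ 2 by nra.
have s2 : 0 <= (5 + e) * ((zs - zc) ^+ 2 * (zs + 2 * zc)).
  by apply: mulr_ge0; [lra|apply: mulr_ge0; [exact: sqr_ge0|lra]].
have s3 : 0 < 2 * e * zs * (1 - zs ^+ 2) by rewrite !mulr_gt0.
have : - (2 * (5 - e) * zs ^+ 3) = - (2 * (5 + e) * zc ^+ 3)
   + (5 + e) * ((zs - zc) ^+ 2 * (zs + 2 * zc)) + 2 * e * zs * (1 - zs ^+ 2).
  transitivity (zs * ((5 - e) * zs ^+ 2 - (k - e))); first by rewrite sE; ring.
  transitivity (zs * ((5 + e) * zs ^+ 2 - (k + e) + 2 * e * (1 - zs ^+ 2))); first ring.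
  by rewrite cE; ring.
by lra.
Qed.

Lemma admissible0 : admissible 0.
Proof.
have [e0 ek ke] := small.
have q0 : 0 < (k + e) / (5 + e) by rewrite divr_gt0; lra.
by split=> //; [rewrite expr0n mulr0|exact/ltW/saddle_above_center].
Qed.

Lemma mid0 : mid 0 = zc.
Proof.
have [e0 ek ke] := small.
rewrite /mid /zc /center_height; congr Num.sqrt.
by field; rewrite gt_eqF; lra.
Qed.

Lemma eye_point_center t : eye_point 0 t = center.
Proof.
have [x0 y0 z0] := eye_pointE 0 t; have [x1 y1 z1] := vec3E (Num.sqrt (1 - zc ^+ 2)) 0 zc.
have yE : eye_y 0 t = 0 by rewrite /eye_y !mul0r.
have zE : eye_z 0 t = zc by rewrite /eye_z mul0r subr0; exact: mid0.
apply: eq_vec3.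
- rewrite [LHS]x0 yE zE expr0n subr0; exact/esym/x1.
- rewrite [LHS]y0 yE; exact/esym/y1.
- rewrite [LHS]z0 zE; exact/esym/z1.
Qed.

Lemma center_eq q : sphere q -> 0 < X q -> Y q = 0 -> Z q = zc -> q = center.
Proof.
move=> sq x0 y0 z0; have [x1 y1 z1] := vec3E (Num.sqrt (1 - zc ^+ 2)) 0 zc.
apply: eq_vec3; rewrite ?x1 ?y1 ?z1 //.
have x2 : X q ^+ 2 = 1 - zc ^+ 2 by rewrite -(sphereXYZ sq) y0 z0; ring.
rewrite -x2.
by rewrite sqrtr_sqr gtr0_norm.
Qed.

Lemma eye_inv q : eye q -> q <> center -> exists d t,
  [/\ 0 < d, admissible d, eye_point d t = q & h q = - eye_level d].
Proof.
move=> [sq [x0 z0 hq]] qc.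
have [m1 m2] := eye_stream_min sq z0.
have [|d [d0 da dv]] := @eye_level_exists (h q) (ltW hq).
  rewrite lt_neqAle m1 andbT; apply/eqP => /esym/m2[y1 z1].
  by apply: qc; exact: center_eq.
have [t _ tq] := eye_point_surj da d0 sq (ltW x0) z0 dv.
by exists d, t.
Qed.

Lemma eye_point_in d t : admissible d -> - eye_level d < es -> eye (eye_point d t).
Proof.
move=> da dl; have [sp x0 z0 hp x1] := eye_pointP t da.
by split=> //; split=> //; [exact: x1|rewrite hp].
Qed.

Lemma center_in_eye : eye center.
Proof.
rewrite -(eye_point_center 0); apply: eye_point_in; first exact: admissible0.
exact: saddle_above_center.
Qed.

(** The levels below the saddles do not meet the edges x = 0 and z = 0 of the
    quarter; this is what keeps the streamlines of the eye inside it. *)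
Lemma quarter_boundary q : sphere q -> 0 <= X q -> 0 <= Z q -> h q < es ->
  0 < X q /\ 0 < Z q.
Proof.
move=> sq x0 z0 hq.
have zn : 0 < Z q.
  rewrite lt_def z0 andbT; apply/eqP => zE; move: hq.
  by rewrite (eye_streamE sq) zE mul0r ltNge ltW.
split=> //; rewrite lt_def x0 andbT; apply/eqP => xE.
by have [le _] := eye_stream_meridian sq z0 xE; move: hq; rewrite ltNge le.
Qed.

Lemma continuous_X : continuous X. Proof. exact: continuous_coord. Qed.
Lemma continuous_Y : continuous Y. Proof. exact: continuous_coord. Qed.
Lemma continuous_Z : continuous Z. Proof. exact: continuous_coord. Qed.

Lemma continuous_h : continuous h.
Proof.
move=> x; have cx := continuous_X (x:=x); have cy := continuous_Y (x:=x).
have cz := continuous_Z (x:=x).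
exact: (ctB (ctB (ctM (ctC 5 x) (ctX 3 cz)) (ctM (ctC k x) cz))
  (ctM (ctM (ctC e x) cz) (ctB (ctX 2 cx) (ctX 2 cy)))).
Qed.

Lemma eye_loop d : 0 < d -> admissible d -> - eye_level d < es ->
  simple_loop (fun a => eye_point d (2 * pi * a))
    [set q | sphere q /\ [/\ 0 < X q, 0 < Z q & h q = - eye_level d]].
Proof.
move=> d0 da dl; have [_ d4 _] := da; have [_ dm _] := midP (ltW d0) d4.
apply: simple_loop_angle.
- move=> t; have ci : {for t, continuous (fun t : R => t)} by exact: cvg_id.
  exact: (ct_eye_point (ctC d t) ci (admissible_z t da)).
- move=> t; rewrite /eye_point /eye_y /eye_stretch /eye_z.
  by rewrite [2 * pi]mulr_natl cosD2pi sinD2pi.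
- by move=> t u; exact: eye_point_inj.
- move=> q; split=> [[sq [x0 z0 hq]]|[t _ <-]].
    exact: (eye_point_surj da d0 sq (ltW x0) z0 hq).
  have [sp x0 z0 hp x1] := eye_pointP t da.
  by split=> //; split=> //; exact: x1.
Qed.

(** The level set has a mirror image in x < 0, so the streamline is only a part of
    it; on the connected streamline min (x, z) cannot vanish. *)
Lemma streamline_eye q : eye q -> q <> center ->
  streamline h q = [set y | sphere y /\ [/\ 0 < X y, 0 < Z y & h y = h q]].
Proof.
move=> eq qc; have [d [t [d0 da tq hq]]] := eye_inv eq qc.
have [sq [x0 z0 hs]] := eq.
have dl : - eye_level d < es by rewrite -hq.
apply/seteqP; split=> y.
  set K := streamline h q => Ky.
  have Kc : connected K by exact: component_connected.
  have Kq : K q by apply: connected_component_refl.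
  have Ks w : K w -> sphere w /\ h w = h q.
    by move=> Kw; have [] := connected_component_sub Kw.
  have cm : continuous (fun w => Num.min (X w) (Z w)).
    by move=> w; exact: (continuous_min (continuous_X (x:=w)) (continuous_Z (x:=w))).
  have [sy hy] := Ks y Ky.
  suff : 0 < Num.min (X y) (Z y) by rewrite lt_min => /andP[].
  rewrite ltNge; apply/negP => my.
  have [|w Kw mw] := @connected_IVT _ _ K _ y q 0 Kc cm Ky Kq.
    by rewrite my le_min !ltW.
  have [sw hw] := Ks w Kw.
  have /andP[xw zw] : (0 <= X w) && (0 <= Z w) by rewrite -le_min mw.
  have [xp zp] : 0 < X w /\ 0 < Z w by apply: quarter_boundary => //; rewrite hw.
  have : 0 < Num.min (X w) (Z w) by rewrite lt_min xp.
  by rewrite mw ltxx.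
rewrite hq => -[sy [xy zy hy]].
have LC := simple_loop_connected (eye_loop d0 da dl).
apply: (connected_component_max _ _ LC); last by [].
  by split.
by move=> w [sw [_ _ hw]]; split=> //=; rewrite hw.
Qed.

Lemma stagnation_quarter q : 0 < X q -> 0 < Z q -> stagnation h q -> q = center.
Proof.
move=> x0 z0 st; have [y0 zE] := stagnation_eye x0 z0 st.
by apply: center_eq => //; case: st.
Qed.

Lemma eye_stream_gt_center q : eye q -> q <> center -> h center < h q.
Proof.
move=> [sq [x0 z0 _]] qc.
have -> : h center = - eye_level 0.
  by rewrite -(eye_point_center 0); have [] := eye_pointP 0 admissible0.
have [m1 m2] := eye_stream_min sq z0; rewrite lt_neqAle m1 andbT.
by apply/eqP => /esym/m2[y1 z1]; apply: qc; exact: center_eq.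
Qed.

Lemma closed_streamline_eye q : eye q -> q <> center -> closed_streamline h q.
Proof.
move=> eq qc; have [d [t [d0 da tq hq]]] := eye_inv eq qc.
have [sq [x0 z0 hs]] := eq.
split.
  by rewrite streamline_eye // hq; eexists; apply: eye_loop => //; rewrite -hq.
rewrite streamline_eye // => w [sw [xw zw hw]] /(stagnation_quarter xw zw) wc.
by have := eye_stream_gt_center eq qc; rewrite -wc hw ltxx.
Qed.

Lemma eye_not_pole w : 0 < X w -> ~ [set north_pole R; south_pole R] w.
Proof.
move=> xw [] wE; move: xw; rewrite wE /X /north_pole /south_pole.
  by have [-> _ _] := sphE 0 (1 : R); rewrite /colat expr1n subrr sqrtr0 mul0r ltxx.
by have [-> _ _] := sphE 0 (-1 : R); rewrite /colat sqrrN expr1n subrr sqrtr0 mul0r ltxx.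
Qed.

(** The homotopy shrinks d to 0 through loops of the eye. *)
Lemma contractible_eye q : eye q -> q <> center ->
  contractible_curve (@cylinder R) (streamline h q).
Proof.
move=> eq qc; have [d [t [d0 da tq hq]]] := eye_inv eq qc.
have [sq [x0 z0 hs]] := eq.
have dl : - eye_level d < es by rewrite -hq.
have Ad (tau : R) : 0 <= tau <= 1 -> admissible ((1 - tau) * d) /\
    eye_level d <= eye_level ((1 - tau) * d).
  move=> t01; apply: admissible_le da; first by apply: mulr_ge0; [lra|exact: ltW].
  by rewrite -[leRHS]mul1r ler_pM2r //; lra.
exists (fun u => eye_point ((1 - u.2) * d) (2 * pi * u.1)); split.
- apply: continuous_in_subspaceT => u; rewrite inE /= => -[_ /=].
  rewrite in_itv /= => u2.
  have c1 : {for u, continuous (fun u : R * R => u.1)} by exact: cvg_fst.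
  have c2 : {for u, continuous (fun u : R * R => u.2)} by exact: cvg_snd.
  apply: (ct_eye_point (ctM (ctB (ctC 1 u) c2) (ctC d u)) (ctM (ctC (2 * pi) u) c1)).
  by apply: admissible_z; have [] := Ad _ u2.
  - move=> w [u [_ /=]]; rewrite in_itv /= => u2 <-.
  have [au lu] := Ad _ u2.
  have [|su [xu zu hu]] := @eye_point_in _ (2 * pi * u.1) au.
    by apply: le_lt_trans dl; rewrite lerN2.
  by split=> //; exact: eye_not_pole.
- rewrite streamline_eye // hq /=.
  under eq_fun do rewrite subr0 mul1r.
  exact: eye_loop.
- move=> tau _ /=; rewrite mulr0 mulr1.
  rewrite /eye_point /eye_y /eye_stretch /eye_z.
  have -> : 2 * pi = pi *+ 2 :> R by rewrite mulr_natl.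
  by rewrite cos0 sin0 cos2pi sin2pi.
- by exists center => a _ /=; rewrite subrr mul0r eye_point_center.
Qed.

(** The minimum of x, z and h q - h vanishes on the sphere only on the streamline; it
    is positive at the center and not positive at a point with x <= 0. *)
Lemma separates_eye q N : eye q -> q <> center -> X N <= 0 ->
  separates (streamline h q) center N.
Proof.
move=> eq qc xN; have [sq [x0 z0 hs]] := eq.
have [sc [xc zc0 hc]] := center_in_eye.
have hcq := eye_stream_gt_center eq qc.
rewrite streamline_eye //; split.
- by move=> [_ [_ _ H]]; move: hcq; rewrite H ltxx.
- by move=> [_ [H _ _]]; move: H; rewrite ltNge xN.
- set K := connected_component _ _ => KN.
  have Kc : connected K by exact: component_connected.
  have Ks w : K w -> (@sphere R `\` [set y | sphere y /\ [/\ 0 < X y, 0 < Z y & h y = h q]]) w.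
    exact: connected_component_sub.
  have Kcen : K center.
    apply: connected_component_refl; split=> // -[_ [_ _ H]].
    by move: hcq; rewrite H ltxx.
  pose f w := Num.min (Num.min (X w) (Z w)) (h q - h w).
  have cf : continuous f.
    move=> w.
    have c1 := continuous_min (continuous_X (x:=w)) (continuous_Z (x:=w)).
    have c2 : {for w, continuous (fun w => h q - h w)}.
      exact: (ctB (ctC (h q) w) (continuous_h (x:=w))).
    exact: (continuous_min c1 c2).
  have [|w Kw fw] := @connected_IVT _ _ K f N center 0 Kc cf KN Kcen.
    rewrite /f !le_min !ge_min xN /= (ltW xc) (ltW zc0) /= subr_ge0 ltW //.
  have [sw nw] := Ks w Kw.
  have /and3P[xw zw hw] : [&& 0 <= X w, 0 <= Z w & 0 <= h q - h w].
    by rewrite andbA -!le_min -/(f w) fw.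
  rewrite subr_ge0 in hw.
  have [xp zp] := quarter_boundary sw xw zw (le_lt_trans hw hs).
  apply: nw; split=> //; split=> //.
  apply/eqP; rewrite eq_le hw /= leNgt; apply/negP => lt.
  have : 0 < f w by rewrite /f !lt_min xp zp subr_gt0.
  by rewrite fw ltxx.
Qed.

Let quarter : set E := [set w | [/\ 0 < X w, 0 < Z w & h w < es]].

Lemma open_quarter : open quarter.
Proof.
have -> : quarter = (X @^-1` [set u | 0 < u]) `&` (Z @^-1` [set u | 0 < u])
    `&` (h @^-1` [set u | u < es]).
  by apply/seteqP; split=> w /=; [move=> [? ? ?]|move=> [[? ?] ?]].
apply: openI; first apply: openI; apply: open_comp; try exact: open_gt;
  try exact: open_lt; move=> w _.
- exact: continuous_X.
- exact: continuous_Z.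
- exact: continuous_h.
Qed.

Lemma centerXYZ : Y center = 0 /\ Z center = zc.
Proof. by have [_ y0 z0] := vec3E (Num.sqrt (1 - zc ^+ 2)) 0 zc. Qed.

Lemma center_eye_center : Defs.center h center.
Proof.
have [sc qc] := center_in_eye; have [yc zcE] := centerXYZ.
split; first exact: center_stagnation.
have := open_nbhs_nbhs (conj open_quarter qc); apply: filterS => q qq sq qc'.
by apply: closed_streamline_eye.
Qed.

(** The curves along which d shrinks to 0 all end at the center. *)
Lemma connected_eye : connected eye.
Proof.
pose I := [set dt : R * R | admissible dt.1 /\ - eye_level dt.1 < es].
pose A (dt : R * R) := (fun s => eye_point s dt.2) @` `[0, dt.1].
have -> : eye = \bigcup_(dt in I) A dt.
  apply/seteqP; split=> q.
    move=> eq; have [->|/eqP qc] := eqVneq q center.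
      exists (0, 0); first by split; [exact: admissible0|exact: saddle_above_center].
      by exists 0; [rewrite /= in_itv /= lexx|exact: eye_point_center].
    have [d [t [d0 da tq hq]]] := eye_inv eq qc.
    exists (d, t); first by split=> //=; rewrite -hq; case: eq => _ [].
    by exists d; [rewrite /= in_itv /= (ltW d0) lexx|].
  move=> [[d t] [/= da dl] [s]]; rewrite /= in_itv /= => /andP[s0 sd] <-.
  have [sa sl] := admissible_le s0 sd da.
  by apply: eye_point_in => //; apply: le_lt_trans dl; rewrite lerN2.
apply: bigcup_connected.
  exists center => -[d t] [/= [d0 _ _] _].
  by exists 0; [rewrite /= in_itv /= lexx|exact: eye_point_center].
move=> [d t] [/= da dl].
apply: connected_continuous_connected; first exact: segment_connected.
apply: continuous_in_subspaceT => s; rewrite inE /= in_itv /= => /andP[s0 sd].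
have ci : {for s, continuous (fun s : R => s)} by exact: cvg_id.
apply: (ct_eye_point ci (ctC t s)).
by apply: admissible_z; have [] := admissible_le s0 sd da.
Qed.

Let boundary : set E := closure eye `\` eye.

(** The defining inequalities pass to the closure in weak form, and a point
    outside of the eye violates a strict one, which forces h to be at the level of
    the saddles. *)
Lemma boundary_sub q : boundary q -> [/\ sphere q, 0 <= X q, 0 < Z q & h q = es].
Proof.
move=> [cq nq].
have cl (f : E -> R) : continuous f -> (forall w, eye w -> 0 <= f w) -> 0 <= f q.
  move=> fc fe; rewrite leNgt; apply/negP => fq.
  have : nbhs q (f @^-1` [set u | u < 0]).
    apply: open_nbhs_nbhs; split=> //; apply: open_comp; last exact: open_lt.
    by move=> w _; exact: fc.
  by move=> /cq[w [/fe w0 /= w1]]; move: w0; rewrite leNgt w1.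
have x0 : 0 <= X q by apply: cl; [exact: continuous_X|move=> w [_ [/ltW]]].
have z0 : 0 <= Z q by apply: cl; [exact: continuous_Z|move=> w [_ [_ /ltW]]].
have hq : 0 <= es - h q.
  apply: (cl (fun w => es - h w)); last by move=> w [_ [_ _ /ltW]]; rewrite subr_ge0.
  by move=> w; exact: ctB (ctC es w) (continuous_h (x:=w)).
pose r w := X w ^+ 2 + Y w ^+ 2 + Z w ^+ 2.
have rc : continuous r.
  move=> w; exact: (ctD (ctD (ctX 2 (continuous_X (x:=w))) (ctX 2 (continuous_Y (x:=w))))
    (ctX 2 (continuous_Z (x:=w)))).
have sq : sphere q.
  apply/sphereP; apply/eqP; rewrite eq_le.
  have r1 : 0 <= r q - 1.
    apply: (cl (fun w => r w - 1)); last by move=> w [/sphereXYZ rw _]; rewrite /r rw subrr.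
    by move=> w; exact: (ctB (rc w) (ctC 1 w)).
  have r2 : 0 <= 1 - r q.
    apply: (cl (fun w => 1 - r w)); last by move=> w [/sphereXYZ rw _]; rewrite /r rw subrr.
    by move=> w; exact: (ctB (ctC 1 w) (rc w)).
  by rewrite -/(X q) -/(Y q) -/(Z q) -/(r q) -subr_ge0 r2 -subr_ge0 r1.
rewrite subr_ge0 in hq.
have hE : h q = es.
  apply/eqP; rewrite eq_le hq leNgt; apply/negP => lt; apply: nq; split=> //.
  by have [xp zp] := quarter_boundary sq x0 z0 lt.
split=> //; rewrite lt_def z0 andbT; apply/eqP => zE.
by have := es0; rewrite -hE (eye_streamE sq) zE mul0r ltxx.
Qed.

Lemma saddle_level_exists : exists ds, [/\ 0 < ds, admissible ds & es = - eye_level ds].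
Proof. by apply: eye_level_exists; [|exact: saddle_above_center]. Qed.

Section Separatrices.
Variable ds : R.
Hypotheses (ds0 : 0 < ds) (dsa : admissible ds) (dsE : es = - eye_level ds).

Lemma separatrix_pointP t : let p := eye_point ds t in
  [/\ sphere p, 0 <= X p, 0 < Z p & h p = es].
Proof. by have [sp x0 z0 hp _] := eye_pointP t dsa; rewrite dsE; split. Qed.

(** Each point of the loop through the saddles is a limit of points of smaller
    loops. *)
Lemma separatrix_point_boundary t : boundary (eye_point ds t).
Proof.
have [sp x0 z0 hp] := separatrix_pointP t.
split; last by move=> [_ [_ _]]; rewrite hp ltxx.
move=> V nV.
have ci : {for ds, continuous (fun s : R => s)} by exact: cvg_id.
have cp := ct_eye_point ci (ctC t ds) (admissible_z t dsa).
have : \forall s \near ds^'-, V (eye_point s t) by exact: cvg_at_left_filter cp _ nV.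
move=> nearV.
near ds^'- => s.
have s0 : 0 < s by near: s; exact: nbhs_left_gt.
have sd : s < ds by near: s; exact: nbhs_left_lt.
exists (eye_point s t); split; last by near: s.
have [sa _] := admissible_le (ltW s0) (ltW sd) dsa.
apply: eye_point_in => //; rewrite dsE ltrN2.
by have [_ d4 _] := dsa; exact: (eye_level_decr (ltW s0) sd d4).
Unshelve. all: by end_near. Qed.

(* the cosine of the angles at which the loop passes through the saddles *)
Let saddle_cos : R := (mid ds - zs) / ds.

Lemma separatrix_saddle t : cos t = saddle_cos -> saddle h (eye_point ds t).
Proof.
move=> ct; have [sp x0 z0 hp] := separatrix_pointP t.
have [_ _ zE] := eye_pointE ds t.
have {}zE : Z (eye_point ds t) = zs.
  rewrite zE /eye_z ct /saddle_cos; field; rewrite gt_eqF //.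
apply: saddle_eye => //; have [s0 _ sE] := saddle_heightP; have [e0 _ _] := small.
have : 2 * e * zs * X (eye_point ds t) ^+ 2 = 0.
  transitivity (zs * ((5 - e) * zs ^+ 2 - (k - e)) - h (eye_point ds t)).
    rewrite (eye_streamE sp) zE.
    have -> : Y (eye_point ds t) ^+ 2 = 1 - X (eye_point ds t) ^+ 2 - zs ^+ 2.
      by rewrite -(sphereXYZ sp) zE; ring.
    by ring.
  by rewrite hp sE /es /saddle_level -/zs; ring.
move/eqP; rewrite mulf_eq0 sqrf_eq0 => /orP[|/eqP//].
by rewrite gt_eqF // !mulr_gt0.
Qed.

Lemma separatrix_regular t : cos t != saddle_cos -> ~ stagnation h (eye_point ds t).
Proof.
move=> ct; have [sp x0 z0 hp] := separatrix_pointP t.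
have [xE|xN] := eqVneq (X (eye_point ds t)) 0.
  have [_ /(_ hp) zE] := eye_stream_meridian sp (ltW z0) xE.
  exfalso; move/eqP: ct; apply.
  have zt : zs = mid ds - ds * cos t.
    by rewrite -[LHS]zE; have [_ _] := eye_pointE ds t.
  by rewrite /saddle_cos zt; field; rewrite gt_eqF.
have xp : 0 < X (eye_point ds t) by rewrite lt_def xN.
move=> /(stagnation_quarter xp z0) pc.
by have [_ [_ _]] := center_in_eye; rewrite -pc hp ltxx.
Qed.

(** The sine does not vanish at the saddles, since y does not. *)
Lemma saddle_cos_lt1 : -1 < saddle_cos < 1.
Proof.
have [s0 s1 sE] := saddle_heightP.
have y0 : 0 < Num.sqrt (1 - zs ^+ 2) by rewrite sqrtr_gt0; nra.
have y2 : Num.sqrt (1 - zs ^+ 2) ^+ 2 = 1 - zs ^+ 2 by rewrite sqr_sqrtr //; nra.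
pose q := vec3 0 (Num.sqrt (1 - zs ^+ 2)) zs.
have [xq yq zq] : [/\ X q = 0, Y q = Num.sqrt (1 - zs ^+ 2) & Z q = zs] by exact: vec3E.
have sq : sphere q by apply/sphereP; rewrite -/(X q) -/(Y q) -/(Z q) xq yq zq y2; ring.
have hq : h q = - eye_level ds.
  rewrite -dsE (eye_streamE sq) yq zq y2 /es /saddle_level -/zs.
  transitivity (zs * ((5 - e) * zs ^+ 2 - (k - e))); first ring.
  by rewrite sE; ring.
have [t _ tq] : exists2 t : R, 0 <= t < 2 * pi & eye_point ds t = q.
  by apply: (eye_point_surj dsa ds0 sq) hq; rewrite -/(X q) -/(Z q) ?xq ?zq.
have [_ yt zt] := eye_pointE ds t; rewrite tq yq zq in yt zt.
have ct : cos t = saddle_cos.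
  by rewrite /saddle_cos zt /eye_z; field; rewrite gt_eqF.
have st : sin t != 0.
  by apply: contraTneq y0 => st0; rewrite yt /eye_y st0 mulr0 mul0r ltxx.
have : 0 < sin t ^+ 2 by rewrite lt_def sqrf_eq0 st sqr_ge0.
rewrite sin2cos2 ct; move: saddle_cos => c c2.
by apply/andP; split; nra.
Qed.

Lemma separatrix_arc (t0 t1 : R) : t0 < t1 -> t1 <= t0 + 2 * pi ->
  cos t0 = saddle_cos -> cos t1 = saddle_cos ->
  (forall t, t0 < t < t1 -> cos t != saddle_cos) ->
  let B := (fun a => eye_point ds (t0 + a * (t1 - t0))) @` `[0, 1] in
  separatrix h B /\ B `<=` boundary.
Proof.
move=> t01 t10 c0 c1 ct B; have [_ d4 _] := dsa.
have [_ dm _] := midP (ltW ds0) d4.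
split; last by move=> w [a _ <-]; exact: separatrix_point_boundary.
exists (fun a => eye_point ds (t0 + a * (t1 - t0))); split=> //.
- split.
    apply: continuous_subspaceT => a.
    have ci : {for a, continuous (fun a : R => a)} by exact: cvg_id.
    exact: (ct_eye_point (ctC ds a) (ctD (ctC t0 a) (ctM ci (ctC (t1 - t0) a)))
      (admissible_z _ dsa)).
  move=> a b; rewrite !inE /= !in_itv /= => a01 b01.
  move=> /(eye_point_inj ds0 dm)[cab sab].
  have d0 : 0 < t1 - t0 by lra.
  have : t0 + a * (t1 - t0) = t0 + b * (t1 - t0).
    apply: angle_inj => //; rewrite opprD addrACA subrr add0r -mulrBl normrM (gtr0_norm d0).
    have : `|a - b| < 1 by rewrite ltr_norml; lra.
    move=> ab; apply: (lt_le_trans (_ : _ < 1 * (t1 - t0))); last lra.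
    by rewrite ltr_pM2r.
  by move=> /addrI/mulIf; apply; rewrite gt_eqF.
- split=> [w [a _ <-]|w [a _ <-]]; first by have [] := separatrix_pointP (t0 + a * (t1 - t0)).
  have [_ _ _ ->] := separatrix_pointP (t0 + a * (t1 - t0)).
  by have [_ _ _ ->] := separatrix_pointP (t0 + 0 * (t1 - t0)).
- by split; apply: separatrix_saddle; rewrite ?mul0r ?addr0 // mul1r subrKC.
- move=> a; rewrite inE /= in_itv /= => /andP[a0 a1]; apply: separatrix_regular; apply: ct.
  have d0 : 0 < t1 - t0 by lra.
  have : 0 < a * (t1 - t0) by rewrite mulr_gt0.
  have : a * (t1 - t0) < 1 * (t1 - t0) by rewrite ltr_pM2r.
  by lra.
Qed.

(** The angles at which the loop meets the saddles are th and -th modulo 2 pi, and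
    the two separatrices are the arcs between them. *)
Lemma separatrix_through q : boundary q ->
  exists B : set E, [/\ separatrix h B, B `<=` boundary & B q].
Proof.
move=> /boundary_sub[sq x0 z0 hq]; rewrite dsE in hq.
have [t t02 tq] := eye_point_surj dsa ds0 sq x0 z0 hq.
have p0 := pi_gt0 R.
have c1 := saddle_cos_lt1.
pose th := acos saddle_cos.
have cth : cos th = saddle_cos by rewrite acosK // in_itv /= !ltW //; case/andP: c1.
have th0 : 0 < th by apply: acos_gt0; case/andP: c1 => /ltW-> ->.
have thp : th < pi by apply: acos_ltpi; case/andP: c1 => -> /ltW->.
have cos2piB (u : R) : cos (2 * pi - u) = cos u.
  by rewrite mulr_natl cosB cos2pi sin2pi mul1r mul0r addr0.
have inj u : 0 <= u <= pi -> cos u = saddle_cos -> u = th.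
  by move=> u0; rewrite -cth; apply: cos_inj; rewrite in_itv /= ?(ltW th0) ?(ltW thp).
have up u : th < u < 2 * pi - th -> cos u != saddle_cos.
  move=> ut; apply/eqP => cu; case: (lerP u pi) => up.
    by have := inj u _ cu; rewrite up andbT; lra.
  by have := inj (2 * pi - u); rewrite cos2piB => /(_ _ cu); lra.
have down u : - th < u < th -> cos u != saddle_cos.
  move=> ut; apply/eqP => cu; have := inj `|u|.
  rewrite cos_norm normr_ge0 /= => /(_ _ cu) H.
  have ult : `|u| < th by rewrite ltr_norml.
  by move: (ult); rewrite H ?ltxx // ltW // (lt_trans ult).
have [lt1 le1] : th < 2 * pi - th /\ 2 * pi - th <= th + 2 * pi by split; lra.
have [lt2 le2] : - th < th /\ th <= - th + 2 * pi by split; lra.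
have [B1 B1s] := separatrix_arc lt1 le1 cth (etrans (cos2piB th) cth) up.
have [B2 B2s] := separatrix_arc lt2 le2 (etrans (cosN th) cth) cth down.
have on_arc (a b u : R) : a < b -> a <= u <= b ->
    ((fun r => eye_point ds (a + r * (b - a))) @` `[0, 1]) (eye_point ds u).
  move=> ab abu; have ba : 0 < b - a by lra.
  exists ((u - a) / (b - a)); last by rewrite divfK ?gt_eqF // subrKC.
  by rewrite /= in_itv /= divr_ge0 ?ler_pdivrMr ?mul1r //; lra.
case: (lerP th t) => tht.
  case: (lerP t (2 * pi - th)) => tt.
    eexists; split; [exact: B1|exact: B1s|].
    by rewrite -tq; apply: on_arc; lra.
  eexists; split; [exact: B2|exact: B2s|].
  have -> : q = eye_point ds (t - 2 * pi).
    rewrite -tq /eye_point /eye_y /eye_stretch /eye_z.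
    have -> : 2 * pi = pi *+ 2 :> R by rewrite mulr_natl.
    by rewrite cosB sinB cos2pi sin2pi !mulr1 !mulr0 addr0 subr0.
  by apply: on_arc; lra.
eexists; split; [exact: B2|exact: B2s|].
by rewrite -tq; apply: on_arc; lra.
Qed.

End Separatrices.

Lemma cats_eye_eye : cats_eye h center eye.
Proof.
have [ds [ds0 dsa dsE]] := saddle_level_exists.
have nN : X (north_pole R) = 0 /\ X (south_pole R) = 0.
  rewrite /X /north_pole /south_pole.
  have [-> _ _] := sphE 0 (1 : R); have [-> _ _] := sphE 0 (-1 : R).
  by rewrite /colat sqrrN expr1n subrr sqrtr0 !mul0r.
split.
- by split; [exact: center_eye_center|exact: center_in_eye].
- split; first exact: connected_eye.
  by exists quarter; split; first exact: open_quarter.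
- move=> q eq qc; split.
  + rewrite streamline_eye // => w [sw [xw zw hw]]; split=> //; split=> //.
    by rewrite hw; case: eq => _ [].
  + exact: closed_streamline_eye.
  + exact: contractible_eye.
  + by apply: separates_eye; rewrite // nN.1.
  + by apply: separates_eye; rewrite // nN.2.
- by move=> q; exact: separatrix_through ds0 dsa dsE q.
Qed.

End Eye.

(** * Cat's eyes and unidirectional waves near the 3-jet *)

Section CatsEyeWave.
Variable R : realType.
Local Notation E := 'rV[R]_3.
Implicit Types (e omega phi s : R).

Definition eye_wave e (x : E) : R :=
  5 * height x ^+ 3 - 3 * height x - e * height x * (x 0 0 ^+ 2 - x 0 1 ^+ 2).

Let modes e := cubic_modes 5 (-3) 0 0 (- e) 0.

Lemma coord_eye_wave e phi s : Defs.coord (eye_wave e) phi s = wave 4 (modes e) phi s.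
Proof.
rewrite wave_cubic /Defs.coord /eye_wave /height; have [-> -> ->] := sphE phi s.
have c2 : cos (2 * phi) = cos phi ^+ 2 - sin phi ^+ 2.
  by rewrite mulr_natl cos_mulr2n sin2cos2 mulr2n; ring.
by rewrite c2; ring.
Qed.

(** The Laplacian multiplies this wave by -12, and c = -omega / 6 makes the absolute
    vorticity -12 times the stream function in the moving frame. *)
Lemma eye_wave_travelling e omega : travelling_wave omega (eye_wave e) (- (omega / 6)).
Proof.
apply: cubic_travelling; first by move=> phi s _; exact: coord_eye_wave.
move=> phi s s1 p.
have Lp : wave_laplacian p = fun k => (-12)%:P * p k.
  rewrite /p laplacian_cubic; apply/funext => -[|[|[|[|j]]]] /=.
  - by rewrite -!mul_polyC; ring.
  - by rewrite -!mul_polyC; ring.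
  - by rewrite -!mul_polyC; ring.
  - ring.
  - by rewrite mulr0.
have Ls : wave_s 4 (wave_laplacian p) phi s = -12 * wave_s 4 p phi s.
  rewrite Lp /wave_s mulr_sumr; apply: eq_bigr => j _.
  by rewrite derivM derivC mul0r add0r !(hornerM, hornerC); ring.
have Lphi : wave_phi 4 (wave_laplacian p) phi s = -12 * wave_phi 4 p phi s.
  rewrite Lp /wave_phi mulr_sumr; apply: eq_bigr => j _.
  by rewrite !(hornerM, hornerC); ring.
by rewrite Ls Lphi; field.
Qed.

(** The perturbation breaks each critical latitude of the zonal profile
    5 z^3 - k z into a chain of two cat's eyes. *)
Lemma cats_eyes_wave (omega eps : R) (w : nat -> R) :
  -18 < omega < 72 -> 0 < eps ->
  exists (Psi : E -> R) (c : R), cats_eyes_travelling_wave omega Psi c /\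
    (sqrte (\sum_(0 <= l <oo)
       (w l * sph_energy (Psi \- three_jet)%R l)%:E) < eps%:E)%E.
Proof.
move=> om eps0.
have [eta eta0 small] := weighted_norm_small w eps0.
pose k := 3 + omega / 6.
pose e := Num.min eta (Num.min (k / 2) ((15 - k) / 3)).
have ke : [/\ 0 < e, e < k, k + 2 * e < 15 & e <= eta].
  have k0 : 0 < k < 15 by rewrite /k; lra.
  have e1 : e <= eta by rewrite ge_min lexx.
  have e2 : e <= k / 2 by rewrite /e !ge_min lexx orbT.
  have e3 : e <= (15 - k) / 3 by rewrite /e !ge_min lexx !orbT.
  have e0 : 0 < e by rewrite /e !lt_min eta0; lra.
  by split=> //; lra.
have [e0 ek k15 ee] := ke.
exists (eye_wave e), (- (omega / 6)); split.
  split; first exact: eye_wave_travelling.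
  have -> : moving_frame (eye_wave e) (- (omega / 6)) = eye_stream k e.
    by apply/funext => x; rewrite /moving_frame /eye_wave /eye_stream /height /k; ring.
  exists (eye_center k e); eexists; apply: cats_eye_eye; by split.
apply: small; apply: (@wave_coefs_le_cubic _ _ 0 0 0 0 (- e) 0 eta (ltW eta0)); rewrite ?normr0 ?(ltW eta0) //.
  move=> phi s _.
  transitivity (Defs.coord (eye_wave e) phi s - Defs.coord three_jet phi s) => //.
  rewrite coord_eye_wave !wave_cubic /Defs.coord /three_jet /height.
  by have [_ _ ->] := sphE phi s; ring.
by rewrite normrN gtr0_norm.
Qed.

End CatsEyeWave.

Unset Implicit Arguments.

Theorem theorem1p6 (R : realType) (lambda : R) (lambda_gt0 : 0 < lambda)
    (omega : R) :
  [/\ (-3 < omega < 69 / 2 ->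
       forall eps : R, 0 < eps ->
       exists (Psi : 'rV[R]_3 -> R) (c : R),
         cats_eyes_travelling_wave omega Psi c /\
         (gevrey_norm lambda (Psi \- three_jet)%R < eps%:E)%E),
      (-18 < omega < -3 \/ 69 / 2 < omega < 72 ->
       forall eps : R, 0 < eps ->
       (exists (Psi : 'rV[R]_3 -> R) (c : R),
          cats_eyes_travelling_wave omega Psi c /\
          (gevrey_norm lambda (Psi \- three_jet)%R < eps%:E)%E) /\
       (exists (Psi : 'rV[R]_3 -> R) (c : R),
          [/\ unidirectional_travelling_wave omega Psi c,
              ~ zonal Psi
            & (sobolev_norm 4 (Psi \- three_jet)%R < eps%:E)%E]))
    & (omega < -18 \/ 72 < omega ->
       forall eps : R, 0 < eps ->
       exists (Psi : 'rV[R]_3 -> R) (c : R),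
         [/\ unidirectional_travelling_wave omega Psi c,
             ~ zonal Psi
           & (gevrey_norm lambda (Psi \- three_jet)%R < eps%:E)%E])].
Proof.
split=> [om eps eps0|om eps eps0|om eps eps0].
- by apply: cats_eyes_wave => //; lra.
- split; first by apply: cats_eyes_wave => //; case: om; lra.
  by apply: tilted_jet_unidirectional => //; case: om => ?; [left|right]; lra.
- by apply: tilted_jet_unidirectional => //; case: om => ?; [left|right]; lra.
Qed.
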